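(* Let $L\subset\mathbb{Z}^n$ be a lattice. The ideal $I_L$ is a binomial complete intersection if and only if either $L^\sigma=\{\mathbf{0}\}$ or there exists a basis of $L^\sigma$ whose vectors give the rows of a mixed dominating matrix.
   Context: Let $\Bbbk$ be a field, $\mathbb{N}=\mathbb{Z}_{\ge0}$. A lattice is a subgroup $L\subset\mathbb{Z}^n$; its lattice ideal is $I_L=\langle x^u-x^v:u,v\in\mathbb{N}^n,\ u-v\in L\rangle\subset\Bbbk[x_1,\ldots,x_n]$. Let $\sigma=\bigcup_{w\in L\cap\mathbb{N}^n}\operatorname{supp}(w)\subset\{1,\dots,n\}$, where $\operatorname{supp}(w)=\{i:w_i\ne0\}$. For $u\in\mathbb{Z}^n$, $u^\sigma=(u_i)_{i\notin\sigma}$ (with $u^\sigma=0$ if $\sigma=\{1,\dots,n\}$). $L^\sigma$ is the lattice generated by the vectors $u^\sigma$, $u\in L$. A lattice ideal of height $r$ is a binomial complete intersection if it can be generated by $r$ binomials, where a binomial means a difference $x^u-x^v$ of two distinct monomials. A matrix $M$ is mixed dominating if every row of $M$ has a positive and a negative entry and $M$ contains no square submatrix with this property. *)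

(* Defs.v *)
From HB Require Import structures.
From mathcomp Require Import all_boot all_order all_algebra.
From mathcomp Require Import mpoly boolp.

Set Implicit Arguments.
Unset Strict Implicit.
Unset Printing Implicit Defensive.

Import Order.TTheory GRing.Theory Num.Theory.
Local Open Scope ring_scope.

(* Subgroups and ideals are boolean predicates, as in [zmodClosed] and
   [prime_idealr]; those given by an existential property are turned into
   boolean ones with the classical reflection `[< _ >]. *)

Section Ideals.
Variable A : comNzRingType.

Definition ideal_gen (S : A -> Prop) : {pred A} :=
  [pred f | `[< exists s : seq (A * A),
      (forall x, x \in s -> S x.2) /\ f = \sum_(x <- s) x.1 * x.2 >]].

Definition strict_sub (I J : {pred A}) : Prop :=
  {subset I <= J} /\ ~ {subset J <= I}.

(* c 0 < c 1 < ... < c h = P ; the values of c beyond h are irrelevant. *)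
Definition has_prime_chain (P : prime_idealr A) (h : nat) : Prop :=
  exists c : nat -> prime_idealr A,
    (c h =i P) /\ (forall i : nat, (i < h)%N -> strict_sub (c i) (c i.+1)).

Definition is_prime_height (P : prime_idealr A) (h : nat) : Prop :=
  has_prime_chain P h /\ (forall h', has_prime_chain P h' -> (h' <= h)%N).

(* The height of I is the minimum of the heights of the primes containing I.
   Primes of infinite height satisfy no [is_prime_height], so they do not
   contribute to the minimum; the unit ideal has no height here. *)
Definition is_height (I : {pred A}) (r : nat) : Prop :=
  (exists P : prime_idealr A, {subset I <= P} /\ is_prime_height P r) /\
  (forall (P : prime_idealr A) (h : nat),
      {subset I <= P} -> is_prime_height P h -> (r <= h)%N).

End Ideals.

Section LatticeIdeal.
Variables (k : fieldType) (n : nat).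

Definition mnm_row (u : 'X_{1..n}) : 'rV[int]_n := \row_(i < n) (u i)%:Z.

Definition lattice_ideal (L : zmodClosed 'rV[int]_n) : {pred {mpoly k[n]}} :=
  ideal_gen (fun f : {mpoly k[n]} =>
    exists u v : 'X_{1..n},
      mnm_row u - mnm_row v \in L /\ f = 'X_[u] - 'X_[v]).

Definition is_binomial (f : {mpoly k[n]}) : Prop :=
  exists u v : 'X_{1..n}, u != v /\ f = 'X_[u] - 'X_[v].

Definition binomial_complete_intersection (I : {pred {mpoly k[n]}}) : Prop :=
  exists r : nat, is_height I r /\
    exists B : r.-tuple {mpoly k[n]},
      (forall b, b \in B -> is_binomial b) /\
      (I =i ideal_gen (fun f => f \in B)).

End LatticeIdeal.

Arguments lattice_ideal k {n} L.

Definition supp n (w : 'rV[int]_n) : {set 'I_n} := [set i | w 0 i != 0].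

Definition sigma n (L : zmodClosed 'rV[int]_n) : {set 'I_n} :=
  [set i | `[< exists w : 'rV[int]_n,
      [/\ w \in L, forall j, 0 <= w 0 j & i \in supp w] >]].

(* The coordinates outside s are renumbered in increasing order. *)
Definition drop_coords n (s : {set 'I_n}) (u : 'rV[int]_n) :
    'rV[int]_(#|~: s|) :=
  \row_j u 0 (enum_val j).

Definition lattice_gen m (S : 'rV[int]_m -> Prop) : {pred 'rV[int]_m} :=
  [pred v | `[< exists s : seq (int * 'rV[int]_m),
      (forall x, x \in s -> S x.2) /\ v = \sum_(x <- s) x.1 *: x.2 >]].

Definition lattice_sigma n (L : zmodClosed 'rV[int]_n) :
    {pred 'rV[int]_(#|~: sigma L|)} :=
  lattice_gen (fun v => exists2 u, u \in L & v = drop_coords (sigma L) u).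

Arguments lattice_sigma {n} L.

Definition rows_basis r m (M : 'M[int]_(r, m)) (L : {pred 'rV[int]_m}) : Prop :=
  (forall c : 'rV[int]_r, c *m M = 0 -> c = 0) /\
  (L =i lattice_gen (fun v => exists i, v = row i M)).

Definition mixed r m (M : 'M[int]_(r, m)) : Prop :=
  forall i, (exists j, 0 < M i j) /\ (exists j, M i j < 0).

(* Being mixed does not depend on the order of the rows and columns, so
   submatrices may be selected by arbitrary injections. The empty submatrix is
   vacuously mixed and has to be excluded; M itself counts if it is square. *)
Definition mixed_dominating r m (M : 'M[int]_(r, m)) : Prop :=
  mixed M /\
  (forall (t : nat) (f : 'I_t -> 'I_r) (g : 'I_t -> 'I_m),
      (0 < t)%N -> injective f -> injective g -> ~ mixed (mxsub f g M)).

(* Main.v *)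
Require Import Defs.
From HB Require Import structures.
From mathcomp Require Import all_boot all_order all_algebra.
From mathcomp Require Import mpoly boolp.
From mathcomp Require Import ssrcomplements.
From mathcomp Require classical_sets.
From mathcomp Require Import zify ring.

(** The bridge between the two sides is the following notion.  A matrix M
    with n columns is connecting ([connects]) when any two points of N^n whose
    difference lies in the lattice spanned by the rows of M are joined by a
    path in N^n whose steps add or subtract a row of M.

    Algebra: I_L is a binomial complete intersection iff L has a connecting
    basis.  Binomials x^a - x^b generate I_L exactly when the moves from c + a
    to c + b join any two points of N^n that are congruent modulo L, because
    for a set of exponents closed under the moves, the sum of the coefficients
    over that set is a linear functional that kills the ideal
    ([class_sum_ideal]).  Generators of I_L thus yield a spanning family of L;
    as the height of I_L is the rank of L ([lattice_ideal_height]), r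
    generators with r the height yield a basis.

    Height: let r be the rank of L.  A prime P above I_L has a chain of length
    r below it: for a suitable variable x_i, the polynomials all of whose
    coefficients with respect to x_i lie in P form a strictly smaller prime
    that still contains the binomials of the elements of L with vanishing i-th
    coordinate, a lattice of rank at least r - 1 ([prime_chain_of_lattice]).
    Conversely, no nonzero element of I_L involves only the n - r variables
    outside a set of pivot columns of L, so some prime P above I_L contains no
    nonzero polynomial in them.  Going down one step in a chain of primes below
    P, the powers of one polynomial multiply the number of linearly
    independent products of bounded degree; comparing with the number of
    monomials bounds the chains by r ([growth_chain], [growth_le]).

    Combinatorics: if no square submatrix of M is mixed, then M is connecting
    ([connects_of_dominating]): for p - q = cM, some row in the support of c
    can be subtracted from p with the sign that makes c smaller, as otherwise
    the columns which obstruct these moves would carry a mixed square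
    submatrix.  Conversely, if M is mixed with independent rows and has a mixed
    square submatrix, there is a set J of columns that has at least as many
    rows mixed on J as elements, all other rows being zero on J.  No move leads
    out of the face x_J = 0, but some combination of the rows mixed on J does
    ([dominating_of_connects]).

    Passage to L^sigma: L contains a vector w of N^n with support sigma.
    Adding multiples of w makes the coordinates in sigma harmless, so a
    connecting basis of L^sigma lifts to L once completed by a basis of the
    kernel K of the projection that contains w up to sign and a factor
    ([connects_of_sigma_basis]).  Conversely, in a connecting basis of L the
    rows that lie in K generate K, since the points of the lattice in N^n are
    joined to 0 by such rows only; the other rows therefore project to a
    connecting basis of L^sigma, which is mixed because L^sigma meets N^n only
    in 0 ([sigma_basis_of_connects]). *)

Set Implicit Arguments.
Unset Strict Implicit.
Unset Printing Implicit Defensive.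

Import Order.TTheory GRing.Theory Num.Theory.
Local Open Scope ring_scope.

(** * Subgroups of Z^m and their bases *)

Definition free_rows r m (M : 'M[int]_(r, m)) :=
  forall c : 'rV[int]_r, c *m M = 0 -> c = 0.

Definition row_span r m (M : 'M[int]_(r, m)) (v : 'rV[int]_m) :=
  exists c : 'rV[int]_r, v = c *m M.

Definition subgroup m (P : 'rV[int]_m -> Prop) :=
  P 0 /\ forall u v, P u -> P v -> P (u - v).

Lemma subgroupZ m (P : 'rV[int]_m -> Prop) (a : int) u :
  subgroup P -> P u -> P (a *: u).
Proof.
case=> P0 PB Pu; have PN v : P v -> P (- v) by rewrite -sub0r; apply: PB.
have Pn d : P (d%:Z *: u).
  elim: d => [|d IHd]; first by rewrite scale0r.
  by rewrite intS scalerDl scale1r -[_ *: u]opprK; apply: PB => //; apply: PN.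
by case: a => d //; rewrite NegzE scaleNr; apply: PN.
Qed.

Lemma subgroupD m (P : 'rV[int]_m -> Prop) u v :
  subgroup P -> P u -> P v -> P (u + v).
Proof.
case=> P0 PB Pu Pv; rewrite -[v]opprK; apply: (PB) => //.
by rewrite -sub0r; apply: PB.
Qed.

Lemma subgroup_sum m (P : 'rV[int]_m -> Prop) (I : Type) (s : seq I)
    (Q : pred I) (F : I -> 'rV[int]_m) :
  subgroup P -> (forall i, Q i -> P (F i)) -> P (\sum_(i <- s | Q i) F i).
Proof.
move=> sP PF; elim/big_rec: _ => [|i x Qi Px]; first by case: sP.
by apply: subgroupD => //; apply: PF.
Qed.

Lemma subgroup_mulmx m (P : 'rV[int]_m -> Prop) r (M : 'M[int]_(r, m)) c :
  subgroup P -> (forall i, P (row i M)) -> P (c *m M).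
Proof.
move=> sP PM; rewrite mulmx_sum_row; apply: subgroup_sum => // i _.
exact: subgroupZ.
Qed.

Lemma row_span_subgroup r m (M : 'M[int]_(r, m)) : subgroup (row_span M).
Proof.
split=> [|u v [c ->] [d ->]]; first by exists 0; rewrite mul0mx.
by exists (c - d); rewrite mulmxBl.
Qed.

Lemma row_span_row r m (M : 'M[int]_(r, m)) i : row_span M (row i M).
Proof. by exists (delta_mx 0 i); rewrite -rowE. Qed.

Lemma zmod_subgroup m (L : zmodClosed 'rV[int]_m) : subgroup (fun v => v \in L).
Proof. by split=> [|u v uL vL]; [apply: rpred0 | apply: rpredB]. Qed.

Lemma lattice_gen_ind m (S P : 'rV[int]_m -> Prop) :
  subgroup P -> (forall u, S u -> P u) -> forall v, v \in lattice_gen S -> P v.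
Proof.
move=> sP SP v /asboolP[s [Ss ->]]; rewrite big_seq; apply: subgroup_sum => //.
by move=> x xs; apply: subgroupZ => //; apply/SP/Ss.
Qed.

Lemma lattice_gen_mem m (S : 'rV[int]_m -> Prop) u :
  S u -> u \in lattice_gen S.
Proof.
move=> Su; apply/asboolP; exists [:: (1, u)]; rewrite big_seq1 scale1r.
by split=> // x; rewrite inE => /eqP->.
Qed.

Lemma lattice_gen_rows r m (M : 'M[int]_(r, m)) v :
  (v \in lattice_gen (fun u => exists i, u = row i M)) <-> row_span M v.
Proof.
split=> [|[c ->]].
  apply: lattice_gen_ind => [|_ [i ->]]; last exact: row_span_row.
  exact: row_span_subgroup.
apply/asboolP; exists [seq (c 0 i, row i M) | i <- enum 'I_r].
split=> [_ /mapP[i _ ->]|]; first by exists i.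
by rewrite mulmx_sum_row big_map big_enum.
Qed.

Lemma rows_basisP r m (M : 'M[int]_(r, m)) (L : {pred 'rV[int]_m}) :
  rows_basis M L <-> free_rows M /\ (forall v, v \in L <-> row_span M v).
Proof.
split=> -[fM LM]; split=> // v; first by rewrite LM; apply: lattice_gen_rows.
by apply/idP/idP => [/LM/lattice_gen_rows|/lattice_gen_rows/LM].
Qed.

Lemma row_span_ind r m (M : 'M[int]_(r, m)) (D : 'rV[int]_m -> Prop) :
  (forall v i, D v <-> D (v + row i M)) ->
  forall v c, D v -> D (v + c *m M).
Proof.
move=> DM v c; rewrite mulmx_sum_row.
have Dn i d w : D w = D (w + d%:Z *: row i M).
  elim: d => [|d ->]; first by rewrite scale0r addr0.
  by rewrite intS scalerDl scale1r addrCA addrC; apply/propext/DM.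
elim: (index_enum _) v => [|i s IHs] v Dv; first by rewrite big_nil addr0.
rewrite big_cons addrA; apply: IHs; case: (c 0 i) => d; first by rewrite -Dn.
by rewrite (Dn i d.+1) NegzE scaleNr addrNK.
Qed.

(** Echelon form, by induction on k for subgroups that live in the first k
    coordinates. The vectors whose last coordinate vanishes have a basis by
    induction; if they are not all of P, Euclidean division shows that it is
    completed by a vector whose last coordinate is positive and minimal. *)
Lemma lattice_basis m (P : 'rV[int]_m -> Prop) : subgroup P ->
  exists r (M : 'M[int]_(r, m)), free_rows M /\ (forall v, P v <-> row_span M v).
Proof.
suff main k : forall P : 'rV[int]_m -> Prop, subgroup P ->
    (forall u, P u -> forall j : 'I_m, (k <= j)%N -> u 0 j = 0) ->
  exists r (M : 'M[int]_(r, m)),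
    free_rows M /\ (forall v, P v <-> row_span M v).
  by move=> sP; apply: (main m) => // u _ j; rewrite leqNgt ltn_ord.
elim: k => {P} [|k IHk] P sP Pk.
  exists 0%N, 0; split=> [c _|v]; first by apply/rowP=> -[].
  split=> [Pv|[c ->]]; last by rewrite mulmx0; case: sP.
  by exists 0; rewrite mulmx0; apply/rowP=> j; rewrite mxE Pk.
have [km|km] := ltnP k m; last first.
  by apply: IHk => // u _ j /(leq_trans km); rewrite leqNgt ltn_ord.
pose j0 := Ordinal km; pose P' u := P u /\ u 0 j0 = 0.
have sP' : subgroup P'.
  case: sP => P0 PB; split; first by split; rewrite ?mxE.
  by move=> u v [Pu u0] [Pv v0]; split; [exact: PB | rewrite !mxE u0 v0 subrr].
have [r [M [fM PM]]]: exists r (M : 'M[int]_(r, m)),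
    free_rows M /\ (forall v, P' v <-> row_span M v).
  apply: IHk => // u [Pu u0] j; rewrite leq_eqVlt => /predU1P[kj|]; last exact: Pk.
  by rewrite (_ : j = j0) //; apply/val_inj.
have [[u Pu u0]|all0] := pselect (exists2 u, P u & u 0 j0 != 0); last first.
  exists r, M; split=> // v; rewrite -PM; split=> [Pv|[]//]; split=> //.
  by apply/eqP; apply: contra_notT all0 => v0; exists v.
(* counting from 0, so that the minimum is that of the positive values *)
have exd : exists d, `[< exists2 u, P u & u 0 j0 = d.+1%:Z >].
  exists `|u 0 j0|.-1; apply/asboolP; exists (sgz (u 0 j0) *: u).
    exact: subgroupZ.
  by rewrite mxE prednK ?absz_gt0 // -abszEsg.
case: (ex_minnP exd) => d /asboolP[w Pw wd] dmin {exd u Pu u0}.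
exists (1 + r)%N, (col_mx w M); split=> [c|v].
  rewrite -[c]hsubmxK mul_row_col => /[dup] cM /rowP/(_ j0).
  have PcM : P' (rsubmx c *m M) by apply/PM; exists (rsubmx c).
  rewrite [RHS]mxE mxE PcM.2 addr0 mxE big_ord1 wd => /eqP; rewrite mulf_eq0 orbF.
  move=> /eqP c0; have {}c0 : lsubmx c = 0.
    by apply/rowP=> i; rewrite ord1 c0 mxE.
  by move: cM; rewrite c0 mul0mx add0r => /fM->; rewrite row_mx0.
split=> [Pv|[c ->]]; last first.
  rewrite -[c]hsubmxK mul_row_col; apply: subgroupD => //; last first.
    by have /PM[] : row_span M (rsubmx c *m M) by exists (rsubmx c).
  by apply: subgroup_mulmx => // i; rewrite ord1 row_id.
pose a := divz (v 0 j0) d.+1%:Z; pose v' : 'rV[int]_m := v - a *: w.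
have Pv' : P v' by case: (sP) => _; apply=> //; apply: subgroupZ.
have v'0 : v' 0 j0 = modz (v 0 j0) d.+1%:Z.
  by rewrite !mxE wd; apply: (canLR (addrK _)); rewrite addrC -divz_eq.
have : P' v'.
  split=> //; apply/eqP; apply: contraT => v'n0.
  pose x := v' 0 j0; have: (`|x|.-1 < d)%N.
    have := ltz_pmod (v 0 j0) (isT : 0 < d.+1%:Z :> int).
    have := modz_ge0 (v 0 j0) (isT : d.+1%:Z != 0 :> int).
    by rewrite -v'0 -/x; lia.
  rewrite ltnNge => /negP[]; apply: dmin; apply/asboolP; exists v' => //.
  have := modz_ge0 (v 0 j0) (isT : d.+1%:Z != 0 :> int).
  by rewrite -v'0 -/x; lia.
move=> /PM[c v'c]; exists (row_mx a%:M c).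
by rewrite mul_row_col mul_scalar_mx -v'c addrC subrK.
Qed.

(** * Matrices without mixed square submatrices are connecting *)

(** The product of the denominators clears a rational dependency. *)
Lemma int_dependency m n (A : 'M[int]_(m, n)) :
  ~~ row_free (map_mx intr A : 'M[rat]_(m, n)) ->
  exists2 c : 'rV[int]_m, c != 0 & c *m A = 0.
Proof.
rewrite -kermx_eq0 => /rowV0Pn[v /sub_kermxP vA v0].
pose D := \prod_i denq (v 0 i).
have D0 : D%:~R != 0 :> rat.
  by rewrite intr_eq0; apply/prodf_neq0 => i _; rewrite denq_neq0.
pose c := \row_i (numq (v 0 i) * \prod_(j | j != i) denq (v 0 j)).
have cE : map_mx intr c = D%:~R *: v.
  apply/rowP=> i; have -> : D = denq (v 0 i) * \prod_(j | j != i) denq (v 0 j).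
    by rewrite /D (bigD1 i).
  by rewrite !mxE !intrM numqE; ring.
exists c.
  apply: contraNneq v0 => c0; move/eqP: cE.
  by rewrite c0 map_mx0 eq_sym scaler_eq0 (negbTE D0).
have cA0 : map_mx intr (c *m A) = 0 :> 'rV[rat]_n.
  by rewrite map_mxM /= cE -scalemxAl vA scaler0.
apply/rowP=> j; apply: (@intr_inj rat); move/rowP/(_ j): cA0.
by rewrite mxE [RHS]mxE [(0 : 'rV[int]_n) 0 j]mxE.
Qed.

(** Either the rows are dependent, or the adjugate provides a combination equal
    to the constant vector |det A|, up to sign. *)
Lemma square_nneg_combination t (A : 'M[int]_t) : (0 < t)%N ->
  exists2 c : 'rV[int]_t, c != 0 & forall j, 0 <= (c *m A) 0 j.
Proof.
move=> t0; have [detA|detA] := eqVneq (\det A) 0.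
  have [|c c0 cA] := @int_dependency _ _ A.
    by rewrite row_free_unit unitmxE det_map_mx detA rmorph0 unitr0.
  by exists c => // j; rewrite cA mxE.
pose c := Num.sg (\det A) *: (const_mx 1 *m \adj A) : 'rV[int]_t.
have cA : c *m A = const_mx `|\det A|.
  rewrite -scalemxAl -mulmxA mul_adj_mx mul_mx_scalar scalerA -normrEsg.
  by apply/rowP=> j; rewrite !mxE mulr1.
exists c => [|j]; last by rewrite cA mxE.
apply: contraNneq detA => c0; move/rowP/(_ (Ordinal t0)): cA.
by rewrite c0 mul0mx !mxE => /esym/normr0_eq0->.
Qed.

Definition nneg m (v : 'rV[int]_m) := forall j, 0 <= v 0 j.

Definition dominating r m (M : 'M[int]_(r, m)) :=
  forall (t : nat) (f : 'I_t -> 'I_r) (g : 'I_t -> 'I_m),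
    (0 < t)%N -> injective f -> injective g -> ~ mixed (mxsub f g M).

(** Union of connected components of the graph on N^m whose edges join x to x +
    row i M: what C says outside of N^m does not matter. *)
Definition move_closed r m (M : 'M[int]_(r, m)) (C : 'rV[int]_m -> Prop) :=
  forall x i, nneg x -> nneg (x + row i M) -> (C x <-> C (x + row i M)).

(** Connectivity is expressed by the unions of components: q lies in every
    union of components that contains p. *)
Definition connects r m (M : 'M[int]_(r, m)) :=
  forall C, move_closed M C -> forall p q, nneg p -> nneg q ->
    row_span M (p - q) -> C p -> C q.

Lemma enum_val_surj (T : finType) (A : {set T}) x :
  x \in A -> exists a : 'I_#|A|, enum_val a = x.
Proof. by move=> xA; exists (enum_rank_in xA x); rewrite enum_rankK_in. Qed.

Lemma sg_neq0 (x : int) : x != 0 -> Num.sg x = 1 \/ Num.sg x = -1.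
Proof. by rewrite neq_lt => /orP[/ltr0_sg->|/gtr0_sg->]; [right|left]. Qed.

(** A set of rows at least as large as J contains the rows of a square
    submatrix on the columns J, so one of its rows has constant sign on J. *)
Lemma dominating_mixed_rows r m (M : 'M[int]_(r, m)) (S : {set 'I_r})
    (J : {set 'I_m}) : dominating M -> (0 < #|J|)%N -> (#|J| <= #|S|)%N ->
  exists2 i, i \in S &
    (forall j, j \in J -> 0 <= M i j) \/ (forall j, j \in J -> M i j <= 0).
Proof.
move=> domM J0 JS; apply: contrapT => mixS.
pose f (a : 'I_#|J|) : 'I_r := enum_val (widen_ord JS a).
apply: (domM _ f (fun a => enum_val a)) => //.
- by move=> a b /enum_val_inj /(congr1 val) /= /val_inj.
- exact: enum_val_inj.
move=> a; have fS : f a \in S by apply: enum_valP.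
split; apply: contrapT => noj; apply: mixS; exists (f a) => //; [right|left].
  move=> j /enum_val_surj[b <-]; rewrite leNgt; apply/negP => Mj.
  by apply: noj; exists b; rewrite mxE.
move=> j /enum_val_surj[b <-]; rewrite leNgt; apply/negP => Mj.
by apply: noj; exists b; rewrite mxE.
Qed.

(** For p, q >= 0 with p - q = cM, the conclusion says that the row i can be
    subtracted from p, or added to it if c_i < 0, since p dominates the
    positive part of cM. If every row i of the support of c is obstructed at
    some column g i, consider among sets S of rows, with cM replaced by the
    partial sum over S, a minimal one that is still obstructed at the columns g
    i. Rows of S which have, after the change of sign by c, no negative entry
    in the columns g(S) may be dropped, since this only lowers the partial sums
    there; some row with a negative entry remains, as the entry of the row i at
    g i exceeds the partial sum there. So all rows of a minimal S are mixed on
    g(S), which has at most as many elements as S. *)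
Lemma dominating_applicable r m (M : 'M[int]_(r, m)) (c : 'rV[int]_r) :
  dominating M -> c != 0 ->
  exists2 i, c 0 i != 0 &
    forall j, Num.sg (c 0 i) * M i j <= Num.max 0 ((c *m M) 0 j).
Proof.
move=> domM cn0; apply: contrapT => none.
have {none} bad i : c 0 i != 0 ->
    exists j, Num.max 0 ((c *m M) 0 j) < Num.sg (c 0 i) * M i j.
  move=> ci; apply: contrapT => noj; apply: none; exists i => // j.
  by rewrite leNgt; apply/negP=> Mj; apply: noj; exists j.
have /rV0Pn[i0 ci0] := cn0; have [j0 _] := bad i0 ci0.
have {bad} /choice[g gP] : forall i, exists j, c 0 i != 0 ->
    Num.max 0 ((c *m M) 0 j) < Num.sg (c 0 i) * M i j.
  move=> i; have [ci|ci] := eqVneq (c 0 i) 0; first by exists j0.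
  by have [j Mj] := bad i ci; exists j.
have csg i j : c 0 i * M i j = `|c 0 i| * (Num.sg (c 0 i) * M i j).
  by rewrite mulrA [`|_| * _]mulrC -numEsg.
(* S ranges over the obstructed sets of rows; start with the support of c *)
suff main k : forall S : {set 'I_r}, (#|S| <= k)%N -> (exists i, i \in S) ->
    (forall i, i \in S -> [/\ c 0 i != 0, 0 < Num.sg (c 0 i) * M i (g i) &
      \sum_(l in S) c 0 l * M l (g i) < Num.sg (c 0 i) * M i (g i)]) -> False.
  apply: (main _ [set i | c 0 i != 0] (leqnn _)); first by exists i0; rewrite inE.
  move=> i; rewrite inE => ci; have := gP i ci; rewrite gt_max => /andP[g0 gi].
  split=> //; apply: le_lt_trans gi; rewrite mxE.
  rewrite [leRHS](bigID (mem [set i | c 0 i != 0])) /=.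
  rewrite [X in _ + X]big1 ?addr0 // => l.
  by rewrite inE negbK => /eqP->; rewrite mul0r.
elim: k => [|k IHk] S Sk [i iS] SP.
  by move: Sk; rewrite leqn0 cards_eq0 => /eqP S0; rewrite S0 inE in iS.
pose S1 := [set i in S | [exists l in S, Num.sg (c 0 i) * M i (g l) < 0]].
have S1S : S1 \subset S by apply/subsetP=> l; rewrite inE => /andP[].
(* if no row can be dropped, all rows of S are mixed on g(S) *)
have [S1E|S1E] := eqVneq S1 S.
  have [||l lS] := @dominating_mixed_rows _ _ M S (g @: S) domM.
  - by apply/card_gt0P; exists (g i); apply: imset_f.
  - exact: leq_imset_card.
  have [cl gl _] := SP l lS; have: l \in S1 by rewrite S1E.
  rewrite inE => /andP[_ /existsP[l' /andP[l'S gl']]].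
  have gJ x : x \in S -> g x \in g @: S by apply: imset_f.
  move: gl gl'; have [->|->] := sg_neq0 cl;
    rewrite ?mul1r ?mulN1r ?oppr_gt0 ?oppr_lt0 => gl gl' [] sM.
  - by have := sM _ (gJ _ l'S); rewrite leNgt gl'.
  - by have := sM _ (gJ _ lS); rewrite leNgt gl.
  - by have := sM _ (gJ _ lS); rewrite leNgt gl.
  - by have := sM _ (gJ _ l'S); rewrite leNgt gl'.
have S1lt : S1 \proper S by rewrite properEneq S1E.
apply: (IHk S1); first by rewrite -ltnS (leq_trans (proper_card S1lt)).
  have [ci gi gl] := SP i iS; apply: contrapT => noS1.
  move: gl; apply/negP; rewrite -leNgt (bigD1 i) //= -[leLHS]addr0.
  apply: lerD.
    rewrite csg ler_peMl ?(ltW gi) //; have: `|c 0 i| != 0 by rewrite normr_eq0.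
    by rewrite -gtz0_ge1 normr_gt0.
  apply: sumr_ge0 => l /andP[lS _]; rewrite csg mulr_ge0 // leNgt.
  apply/negP=> lneg; apply: noS1; exists l; rewrite inE lS.
  by apply/existsP; exists i; rewrite iS.
move=> l lS1; have lS := subsetP S1S l lS1; have [cl gl sl] := SP l lS.
split=> //; apply: le_lt_trans sl; rewrite [leRHS](big_setID S1) /=.
rewrite (setIidPr S1S) lerDl; apply: sumr_ge0 => l' /setDP[l'S l'S1].
rewrite csg mulr_ge0 // leNgt; apply: contra l'S1 => l'neg; rewrite inE l'S.
by apply/existsP; exists l; rewrite lS.
Qed.

(** Induction on the sum of the |c_i|, where p - q = cM: the move found by
    [dominating_applicable] lowers it. *)
Lemma connects_of_dominating r m (M : 'M[int]_(r, m)) :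
  dominating M -> connects M.
Proof.
move=> domM C CM p q p0 q0 [c pqc].
have [k] := ubnP (\sum_i absz (c 0%R i)) .
elim: k => // k IHk in c p p0 pqc * => ck Cp.
have [c0|cn0] := eqVneq c 0.
  by move: pqc; rewrite c0 mul0mx => /eqP; rewrite subr_eq0 => /eqP<-.
have [i ci iM] := dominating_applicable domM cn0.
pose s := Num.sg (c 0 i); pose p' := p - s *: row i M.
have p'0 : nneg p'.
  move=> j; rewrite !mxE subr_ge0; apply: le_trans (iM j) _.
  by rewrite ge_max p0 -pqc !mxE gerBl q0.
apply: (IHk (c - s *: delta_mx 0 i) p') => //.
- by rewrite mulmxBl -scalemxAl -rowE -pqc /p' addrAC.
- move: ck; rewrite ltnS; apply: leq_trans.
  rewrite (bigD1 i) // [leqRHS](bigD1 i) //= -addSn.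
  apply: leq_add; last first.
    by apply: leq_sum => l li; rewrite !mxE (negbTE li) andbF mulr0 subr0.
  by rewrite !mxE !eqxx mulr1 /s; case: (sgrP (c 0 i)) ci => //=; lia.
have p'E : p = p' + s *: row i M by rewrite subrK.
move: Cp; rewrite p'E /s in p0 *; have [sE|sE] := sg_neq0 ci; rewrite sE in p0 *.
  rewrite scale1r => Cp; apply/(CM _ i) => //; by rewrite scale1r in p0.
rewrite scaleN1r in p0 *; move=> Cp.
rewrite -[p'](subrK (row i M)); apply/(CM (p' - row i M) i); rewrite ?subrK //.
Qed.

(** * Mixed connecting bases are dominating *)

(** Extension by zero of a vector of coefficients from some of the rows to all
    of them. *)
Lemma row_extension t r (e : 'I_t -> 'I_r) (c : 'rV[int]_t) : injective e ->
  exists c' : 'rV[int]_r,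
    (forall a, c' 0 (e a) = c 0 a) /\
    (forall m (M : 'M[int]_(r, m)), c' *m M = c *m rowsub e M).
Proof.
move=> inje; exists (c *m rowsub e 1%:M); split=> [a|m M].
- rewrite mxE (bigD1 a) //= !mxE eqxx mulr1 big1 ?addr0 // => b ba.
  by rewrite !mxE (inj_eq inje) (negbTE ba) mulr0.
- by rewrite -mulmxA mul_rowsub_mx mul1mx.
Qed.

Definition pos_part m (u : 'rV[int]_m) : 'rV[int]_m := \row_j Num.max 0 (u 0 j).

Lemma pos_part_nneg m (u : 'rV[int]_m) : nneg (pos_part u).
Proof. by move=> j; rewrite mxE le_max lexx. Qed.

Lemma pos_part_sub m (u : 'rV[int]_m) : pos_part u - pos_part (- u) = u.
Proof.
apply/rowP=> j; rewrite !mxE !maxEle oppr_ge0.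
by case: (ltrgtP (u 0 j) 0) => [_|_|->]; rewrite ?opprK ?add0r ?oppr0 ?addr0.
Qed.

Definition mixed_rows r m (M : 'M[int]_(r, m)) (J : {set 'I_m}) : {set 'I_r} :=
  [set i | [exists j in J, 0 < M i j] && [exists j in J, M i j < 0]].

Lemma mixed_rowsS r m (M : 'M[int]_(r, m)) (J J' : {set 'I_m}) :
  J \subset J' -> mixed_rows M J \subset mixed_rows M J'.
Proof.
move=> /subsetP JJ'; apply/subsetP=> i; rewrite !inE.
move=> /andP[/existsP[a /andP[/JJ' aJ Ma]] /existsP[b /andP[/JJ' bJ Mb]]].
by apply/andP; split; apply/existsP; [exists a | exists b]; apply/andP.
Qed.

(** Take J maximal among the sets of columns with at least as many mixed rows
    as elements. If a row not mixed on J were nonzero on J, then adding to J a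
    column where this row has the missing sign would give one more column and
    one more mixed row. *)
Lemma maximal_mixed_columns r m (M : 'M[int]_(r, m)) (J0 : {set 'I_m}) :
  mixed M -> (0 < #|J0|)%N -> (#|J0| <= #|mixed_rows M J0|)%N ->
  exists J : {set 'I_m}, [/\ (0 < #|J|)%N, (#|J| <= #|mixed_rows M J|)%N &
    forall i j, i \notin mixed_rows M J -> j \in J -> M i j = 0].
Proof.
move=> mixM J00 J0M; pose P (J : {set 'I_m}) := (0 < #|J|)%N && (#|J| <= #|mixed_rows M J|)%N.
have PJ0 : P J0 by rewrite /P J00.
case: (arg_maxnP (fun J : {set 'I_m} => #|J|%N) PJ0) => J /andP[Jn0 JM] maxJ.
exists J; split=> // i j iJ jJ; apply/eqP; apply: contraT => Mij.
suff [j' j'J iJ'] : exists2 j', j' \notin J & i \in mixed_rows M (j' |: J).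
  have := maxJ (j' |: J); rewrite /P cardsU1 j'J /= add1n ltnn => -> //.
  have /subset_leq_card : i |: mixed_rows M J \subset mixed_rows M (j' |: J).
    by rewrite subUset sub1set iJ' mixed_rowsS ?subsetUr.
  by rewrite cardsU1 iJ; apply: leq_trans.
have [[jp Mp] [jn Mn]] := mixM i.
have [|Mpos] := ltrP (M i j) 0 => [Mneg|]; last first.
  have {}Mpos : 0 < M i j by rewrite lt_neqAle eq_sym Mij.
  exists jn.
    apply: contra iJ => jnJ; rewrite inE.
    by apply/andP; split; apply/existsP; [exists j | exists jn]; apply/andP.
  rewrite inE; apply/andP; split; apply/existsP; [exists j | exists jn].
    by rewrite !inE jJ orbT.
  by rewrite !inE eqxx.
exists jp.
  apply: contra iJ => jpJ; rewrite inE.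
  by apply/andP; split; apply/existsP; [exists jp | exists j]; apply/andP.
rewrite inE; apply/andP; split; apply/existsP; [exists jp | exists j].
  by rewrite !inE eqxx.
by rewrite !inE jJ orbT.
Qed.

(** If M has a mixed square submatrix, let J be as in [maximal_mixed_columns].
    From a point of N^m with x_J = 0 a row mixed on J is not applicable with
    either sign, and the other rows preserve x_J = 0; so the component of such
    a point stays in its translate by the lattice of those other rows. But the
    rows mixed on J, being at least as many as the elements of J, have a
    nontrivial combination u with u_J >= 0, and then the negative part q of u
    satisfies q_J = 0, while q + u is a point of N^m that is not in that
    translate. *)
Lemma dominating_of_connects r m (M : 'M[int]_(r, m)) :
  mixed M -> free_rows M -> connects M -> dominating M.
Proof.
move=> mixM freeM connM t f g t0 injf injg mixfg.
have [||J [J0 JM MJ0]] := @maximal_mixed_columns _ _ M (g @: setT) mixM.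
- by rewrite card_imset // cardsT card_ord.
- rewrite card_imset // -(card_imset setT injf); apply/subset_leq_card/subsetP.
  move=> _ /imsetP[a _ ->]; have [[b Mb] [b' Mb']] := mixfg a; rewrite inE.
  rewrite !mxE in Mb Mb'.
  by apply/andP; split; apply/existsP; [exists (g b)|exists (g b')]; rewrite imset_f.
pose e (a : 'I_#|J|) : 'I_r := enum_val (widen_ord JM a).
have inje : injective e.
  by move=> a b /enum_val_inj /(congr1 val) /= /val_inj.
have eM a : e a \in mixed_rows M J by apply: enum_valP.
have [c c0 cJ] := square_nneg_combination (mxsub e enum_val M) J0.
have [c' [c'c c'M]] := row_extension c inje.
pose u := c' *m M; pose q := pos_part (- u).
have uJ j : j \in J -> 0 <= u 0 j.
  move=> /enum_val_surj[a <-]; rewrite /u c'M; apply: le_trans (cJ a) _.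
  by rewrite !mxE le_eqVlt; apply/orP; left; apply/eqP/eq_bigr => b _; rewrite !mxE.
pose C (x : 'rV[int]_m) := (forall j, j \in J -> x 0 j = 0) /\
  exists d : 'rV[int]_r,
    (forall i, i \in mixed_rows M J -> d 0 i = 0) /\ x - q = d *m M.
have CM : move_closed M C.
  move=> x i x0 xi0; have [iJ|iJ] := boolP (i \in mixed_rows M J).
    rewrite inE in iJ;
    have /andP[/existsP[jp /andP[jpJ Mp]] /existsP[jn /andP[jnJ Mn]]] := iJ.
    split=> -[xJ _]; exfalso.
      by have := xi0 jn; rewrite !mxE xJ // add0r leNgt Mn.
    have := xJ jp jpJ; rewrite !mxE => /eqP; rewrite addr_eq0 => /eqP xp.
    by have := x0 jp; rewrite xp oppr_ge0 leNgt Mp.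
  have xiJ j : j \in J -> (x + row i M) 0 j = x 0 j.
    by move=> jJ; rewrite !mxE MJ0 // addr0.
  split=> -[xJ [d [dJ xd]]]; split.
  - by move=> j jJ; rewrite xiJ // xJ.
  - exists (d + delta_mx 0 i); split=> [l lJ|].
      by rewrite !mxE dJ // eqxx; case: eqP iJ => // <-; rewrite lJ.
    by rewrite mulmxDl -rowE -xd addrAC.
  - by move=> j jJ; rewrite -xiJ // xJ.
  - exists (d - delta_mx 0 i); split=> [l lJ|].
      by rewrite !mxE dJ // eqxx; case: eqP iJ => // <-; rewrite lJ.
    by rewrite mulmxBl -rowE -xd [x + _ - q]addrAC addrK.
have Cq : C q.
  split=> [j jJ|]; first by rewrite mxE max_l // mxE oppr_le0 uJ.
  by exists 0; rewrite mul0mx subrr; split=> // i _; rewrite mxE.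
have [_ [d [dJ du]]] : C (pos_part u).
  apply: (connM C CM q) => //; try exact: pos_part_nneg.
  by exists (- c'); rewrite mulNmx -opprB pos_part_sub.
have dc : d = c'.
  apply/eqP; rewrite -subr_eq0; apply/eqP/freeM.
  by rewrite mulmxBl -du pos_part_sub subrr.
case/negP: c0; apply/eqP/rowP=> a; rewrite -c'c -dc dJ ?mxE //.
Qed.

(** * From a connecting basis of L to a basis of L^sigma *)

Section Sigma.
Variables (n : nat) (L : zmodClosed 'rV[int]_n).
Local Notation s := (sigma L).

Definition drop_mx (T : {set 'I_n}) : 'M[int]_(n, #|~: T|) :=
  colsub (enum_val : 'I_#|~: T| -> 'I_n) 1%:M.

Lemma drop_coordsE T (u : 'rV[int]_n) : drop_coords T u = u *m drop_mx T.
Proof. by rewrite mulmx_colsub mulmx1; apply/rowP=> j; rewrite !mxE. Qed.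

Lemma drop_coordsP T (P : int -> Prop) (u : 'rV[int]_n) :
  (forall j, P (drop_coords T u 0 j)) <-> (forall i, i \notin T -> P (u 0 i)).
Proof.
split=> Pu i; last by rewrite mxE; apply: Pu; have := enum_valP i; rewrite inE.
move=> iT; have /enum_val_surj[j <-] : i \in ~: T by rewrite inE.
by have := Pu j; rewrite mxE.
Qed.

Lemma drop_coords_eq0 T (u : 'rV[int]_n) :
  drop_coords T u = 0 <-> (forall i, i \notin T -> u 0 i = 0).
Proof.
rewrite -(drop_coordsP T (fun x => x = 0)); split=> [->|u0].
  by move=> j; rewrite mxE.
by apply/rowP=> j; rewrite u0 mxE.
Qed.

(** The support of a sum of nonnegative vectors is the union of their supports. *)
Lemma sigma_witness :
  exists w, [/\ w \in L, nneg w & forall i, (i \in s) = (w 0 i != 0)].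
Proof.
have /choice[W WP] : forall i, exists w,
    [/\ w \in L, nneg w & i \in s -> w 0 i != 0].
  move=> i; have [/[!inE]/asboolP[w [wL w0 wi]]|_] := boolP (i \in s).
    by exists w; split=> // _; rewrite inE in wi.
  by exists 0; split=> [|j|//]; [apply: rpred0 | rewrite mxE].
have WS i : (\sum_j W j) 0 i = \sum_j W j 0 i by rewrite summxE.
have S0 : nneg (\sum_j W j).
  by move=> i; rewrite WS; apply: sumr_ge0 => j _; have [] := WP j.
have SL : \sum_j W j \in L by apply: rpred_sum => j _; have [] := WP j.
exists (\sum_j W j); split=> // i; apply/idP/idP => [is_|Si]; last first.
  by rewrite inE; apply/asboolP; exists (\sum_j W j); split; rewrite ?inE.
rewrite WS psumr_neq0 => [|j _]; last by have [] := WP j.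
apply/hasP; exists i; rewrite ?mem_index_enum //= lt_neqAle eq_sym.
by have [_ /(_ i)-> /(_ is_)->] := WP i.
Qed.

Lemma lattice_sigmaP v :
  v \in lattice_sigma L <-> exists2 u, u \in L & v = drop_coords s u.
Proof.
split=> [|uv]; last exact: lattice_gen_mem.
apply: (lattice_gen_ind (P := fun v => exists2 u, u \in L & v = drop_coords s u)).
  split=> [|_ _ [u uL ->] [v' vL ->]].
    by exists 0; rewrite ?rpred0 // drop_coordsE mul0mx.
  by exists (u - v'); rewrite ?rpredB // !drop_coordsE mulmxBl.
by [].
Qed.

Lemma nneg_mul_add (w v : 'rV[int]_n) :
  nneg w -> (forall i, w 0 i = 0 -> 0 <= v 0 i) ->
  exists T : nat, forall t : nat, (T <= t)%N -> nneg (v + t%:Z *: w).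
Proof.
move=> w0 wv; exists (\sum_i absz (v ord0 i)) => t Tt i; rewrite !mxE.
have [wi|wi] := eqVneq (w 0 i) 0; first by rewrite wi mulr0 addr0 wv.
have : (absz (v ord0 i) <= t)%N.
  by apply: leq_trans Tt; rewrite (bigD1 i) //= leq_addr.
have : 1 <= w 0 i by rewrite -gtz0_ge1 lt_neqAle eq_sym wi w0.
by move: (w 0 i) (v ord0 i) => x y; nia.
Qed.

(** L^sigma meets the orthant only in 0: adding a large multiple of a vector of
    full support sigma makes u nonnegative, so the support of u lies in sigma. *)
Lemma nneg_drop_eq0 u : u \in L -> nneg (drop_coords s u) ->
  drop_coords s u = 0.
Proof.
move=> uL /(drop_coordsP s (fun x => 0 <= x)) u0; apply/drop_coords_eq0 => i is_.
have [w [wL w0 ws]] := sigma_witness.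
have [|T /(_ _ (leqnn _)) Tu] := @nneg_mul_add w u w0.
  by move=> j /eqP wj; apply: u0; rewrite ws negbK.
have /eqP wi : w 0 i == 0 by rewrite -[_ == _]negbK -ws.
apply/eqP; apply: contraNT is_ => ui; rewrite inE; apply/asboolP.
exists (u + T%:Z *: w); split=> //; last by rewrite inE !mxE wi mulr0 addr0.
by rewrite rpredD //; apply: (subgroupZ _ (zmod_subgroup L)).
Qed.

(** A path in N^n from 0 to a point of L stays in L, hence is supported in
    sigma, so it uses only rows supported in sigma. Every v of L supported in
    sigma is a difference v + T w - T w of two such points. *)
Lemma drop_zero_span r (M : 'M[int]_(r, n)) :
  (forall v, v \in L <-> row_span M v) -> connects M ->
  forall v, v \in L -> drop_coords s v = 0 -> exists c : 'rV[int]_r,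
    (forall i, drop_coords s (row i M) != 0 -> c 0 i = 0) /\ v = c *m M.
Proof.
move=> LM connM.
pose K v := exists c : 'rV[int]_r,
  (forall i, drop_coords s (row i M) != 0 -> c 0 i = 0) /\ v = c *m M.
have subK : subgroup K.
  split=> [|_ _ [c [cP ->]] [d [dP ->]]].
    by exists 0; rewrite mul0mx; split=> // i _; rewrite mxE.
  by exists (c - d); rewrite mulmxBl; split=> // i iP; rewrite !mxE cP // dP.
have Krow i : drop_coords s (row i M) = 0 -> K (row i M).
  move=> i0; exists (delta_mx 0 i); rewrite -rowE; split=> // l il.
  by rewrite mxE eqxx; have [li|//] := eqVneq l i; rewrite li i0 eqxx in il.
have rowL i : row i M \in L by apply/LM/row_span_row.
have nonnegK v : v \in L -> nneg v -> K v.
  move=> vL v0; pose C x := x \in L /\ K x.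
  have CM : move_closed M C.
    have drop0 x : nneg x -> x \in L -> drop_coords s x = 0.
      move=> x0 xL; apply: nneg_drop_eq0 => //.
      by apply/(drop_coordsP s (fun a => 0 <= a)) => i _.
    move=> x i x0 xi0; split=> -[xL Kx].
      have xiL : x + row i M \in L by rewrite rpredD.
      split=> //; apply: subgroupD => //; apply: Krow.
      have := drop0 _ xi0 xiL; rewrite drop_coordsE mulmxDl -!drop_coordsE.
      by rewrite (drop0 x) // add0r.
    have xL' : x \in L by rewrite -[x](addrK (row i M)) rpredB.
    split=> //; rewrite -[x](addrK (row i M)); case: (subK) => _; apply=> //.
    apply: Krow; have := drop0 _ xi0 xL; rewrite drop_coordsE mulmxDl.
    by rewrite -!drop_coordsE (drop0 x) // add0r.
  have [] // : C v; apply: (connM C CM 0) => //; first by move=> j; rewrite mxE.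
    by apply/LM; rewrite sub0r rpredN.
  by split; [apply: rpred0 | case: subK].
move=> v vL /drop_coords_eq0 v0; have [w [wL w0 ws]] := sigma_witness.
have [|T /(_ _ (leqnn _)) Tv] := @nneg_mul_add w v w0.
  by move=> j /eqP wj; rewrite v0 // ws negbK.
have TwL : T%:Z *: w \in L by apply: (subgroupZ _ (zmod_subgroup L)).
rewrite -/(K v) -[v](addrK (T%:Z *: w)); case: subK => _; apply.
  by apply: nonnegK => //; rewrite rpredD.
by apply: nonnegK => // j; rewrite mxE mulr_ge0.
Qed.

(** The rows of M that survive the projection form the required basis: they are
    independent because the rows killed by the projection already span its
    kernel, and they are connecting because two points of the projected orthant
    lift, after adding a multiple of w, to points of N^n. *)
Lemma sigma_basis_of_connects r (M : 'M[int]_(r, n)) :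
  free_rows M -> (forall v, v \in L <-> row_span M v) -> connects M ->
  exists r' (M' : 'M[int]_(r', #|~: s|)),
    rows_basis M' (lattice_sigma L) /\ mixed_dominating M'.
Proof.
move=> freeM LM connM; pose R := [set i | drop_coords s (row i M) != 0].
pose e (a : 'I_#|R|) : 'I_r := enum_val a.
have inje : injective e by apply: enum_val_inj.
have eR a : drop_coords s (row (e a) M) != 0.
  by have := enum_valP a; rewrite inE.
pose M' := rowsub e M *m drop_mx s.
have rowM' a : row a M' = drop_coords s (row (e a) M).
  by rewrite row_mul row_rowsub drop_coordsE.
have rowL i : row i M \in L by apply/LM/row_span_row.
have spanM' v : v \in lattice_sigma L <-> row_span M' v.
  rewrite lattice_sigmaP; split=> [[_ /LM[c ->] ->]|[c ->]].
    rewrite drop_coordsE (mulmx_sum_row c M) mulmx_suml; apply: subgroup_sum.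
      exact: row_span_subgroup.
    move=> i _; rewrite -scalemxAl -drop_coordsE.
    have [->|iR] := eqVneq (drop_coords s (row i M)) 0.
      by rewrite scaler0; case: (row_span_subgroup M').
    apply: subgroupZ; first exact: row_span_subgroup.
    have /enum_val_surj[a ai] : i \in R by rewrite inE.
    by rewrite -ai -rowM'; apply: row_span_row.
  exists (c *m rowsub e M); last by rewrite drop_coordsE mulmxA.
  apply: (subgroup_mulmx _ (zmod_subgroup L)) => a; rewrite row_rowsub.
  exact: rowL.
have freeM' : free_rows M'.
  move=> c cM'; have [c' [c'c c'M]] := row_extension c inje.
  have [||d [dR dM]] := drop_zero_span LM connM (v := c' *m M).
  - by apply/LM; exists c'.
  - by rewrite drop_coordsE c'M -mulmxA.
  have dc : c' = d.
    by apply/eqP; rewrite -subr_eq0; apply/eqP/freeM; rewrite mulmxBl dM subrr.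
  by apply/rowP=> a; rewrite -c'c dc dR ?mxE.
have mixM' : mixed M'.
  have nonneg v : v \in lattice_sigma L -> nneg v -> v = 0.
    by move=> /lattice_sigmaP[u uL ->]; apply: nneg_drop_eq0.
  have rowM'L a : row a M' \in lattice_sigma L by apply/spanM'/row_span_row.
  move=> a; split; apply: contrapT => no; case/eqP: (eR a); rewrite -rowM'.
    apply: oppr_inj; rewrite oppr0; apply: nonneg.
      apply/spanM'; case: (row_span_row M' a) => c ->.
      by exists (- c); rewrite mulNmx.
    move=> j; rewrite !mxE oppr_ge0 leNgt; apply/negP=> Mj.
    by apply: no; exists j; rewrite mxE.
  apply: nonneg => // j; rewrite mxE leNgt; apply/negP=> Mj.
  by apply: no; exists j.
have connM' : connects M'.
  move=> C CM' p q p0 q0 /spanM'/lattice_sigmaP[u uL pqu] Cp.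
  pose D x := C (drop_coords s x).
  have dropD x y : drop_coords s (x + y) = drop_coords s x + drop_coords s y.
    by rewrite !drop_coordsE mulmxDl.
  have drop_nneg x : nneg x -> nneg (drop_coords s x).
    by move=> x0; apply/(drop_coordsP s (fun a => 0 <= a)) => i _.
  have DM : move_closed M D.
    move=> x i x0 xi0; rewrite /D dropD.
    have [->|iR] := eqVneq (drop_coords s (row i M)) 0; first by rewrite addr0.
    have /enum_val_surj[a ai] : i \in R by rewrite inE.
    have rowi : drop_coords s (row i M) = row a M' by rewrite rowM' -ai.
    have := drop_nneg _ xi0; rewrite dropD rowi => di0.
    by apply: CM' => //; apply: drop_nneg.
  have [w [wL w0 ws]] := sigma_witness.
  have dropw t : drop_coords s (t *: w) = 0.
    rewrite drop_coordsE -scalemxAl -drop_coordsE.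
    rewrite (drop_coords_eq0 s w).2 ?scaler0 // => i is_.
    by apply/eqP; rewrite -[_ == _]negbK -ws.
  pose q1 := q *m (drop_mx s)^T.
  have dropq1 : drop_coords s q1 = q.
    rewrite drop_coordsE -mulmxA /drop_mx trmx_mxsub trmx1 mul_rowsub_mx mul1mx.
    rewrite (_ : rowsub _ _ = 1%:M) ?mulmx1 //; apply/matrixP=> i j.
    by rewrite !mxE (inj_eq enum_val_inj).
  have [|T qT] := @nneg_mul_add w q1 w0.
    move=> i /eqP wi; move: i wi; have := q0; rewrite -{1}dropq1.
    move=> /(drop_coordsP s (fun x => 0 <= x)) q10 i wi; apply: q10.
    by rewrite ws negbK.
  have dropq1u : drop_coords s (q1 + u) = p by rewrite dropD dropq1 -pqu addrC subrK.
  have [|T' pT] := @nneg_mul_add w (q1 + u) w0.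
    move=> i /eqP wi; move: i wi; have := p0; rewrite -{1}dropq1u.
    move=> /(drop_coordsP s (fun x => 0 <= x)) p10 i wi; apply: p10.
    by rewrite ws negbK.
  pose t := (T + T')%N; have := connM D DM (q1 + u + t%:Z *: w) (q1 + t%:Z *: w).
  rewrite /D dropD dropw addr0 dropq1u dropD dropw addr0 dropq1; apply=> //.
  - by apply: pT; rewrite leq_addl.
  - by apply: qT; rewrite leq_addr.
  - by apply/LM; rewrite opprD addrACA subrr addr0 [q1 + u]addrC addrK.
exists #|R|, M'; split; first exact/rows_basisP.
by split=> //; apply: dominating_of_connects.
Qed.
End Sigma.

(** * From a connecting basis of L^sigma to one of L *)

(** Smith normal form of a matrix with one row. *)
Lemma row_multiple_unimodular r (a : 'rV[int]_r) : a != 0 ->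
  exists (U : 'M[int]_r) i d, U \in unitmx /\ a = d *: row i U.
Proof.
case: r a => [|r] a a0; first by case/eqP: a0; apply/rowP=> -[].
have [l _ [U Uunit [d _ ->]]] := int_Smith_normal_form a.
exists U, 0, (l 0 0 * d`_0); split=> //.
rewrite [l in LHS]mx11_scalar -mulmxA mul_scalar_mx -scalerA; congr (_ *: _).
apply/rowP=> j; rewrite !mxE big_ord_recl !mxE eqxx big1 ?addr0 // => i _.
by rewrite !mxE mul0r.
Qed.

(** Up to a factor d, a nonzero lattice vector belongs to some basis; the sign
    of d makes the basis vector nonnegative again. *)
Lemma nneg_adapted_basis r n (N : 'M[int]_(r, n)) (w : 'rV[int]_n) :
  free_rows N -> row_span N w -> nneg w ->
  exists (N' : 'M[int]_(r, n)) w',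
    [/\ free_rows N', forall v, row_span N' v <-> row_span N v,
        nneg w' /\ (forall j, (w' 0 j == 0) = (w 0 j == 0)) &
        w' = 0 \/ exists i, w' = row i N' \/ w' = - row i N'].
Proof.
move=> freeN [a wa] w0; have [a0|an0] := eqVneq a 0.
  exists N, 0; split=> //; last by left.
  by split=> [j|j]; rewrite mxE // wa a0 mul0mx mxE.
have [U [i [d [Uunit ad]]]] := row_multiple_unimodular an0.
have wd : w = d *: row i (U *m N) by rewrite wa ad -scalemxAl row_mul.
have dn0 : d != 0 by apply: contraNneq an0 => d0; rewrite ad d0 scale0r.
exists (U *m N), (Num.sg d *: row i (U *m N)); split.
- move=> c; rewrite mulmxA => /freeN cU.
  by rewrite -[c]mulmx1 -(mulmxV Uunit) mulmxA cU mul0mx.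
- move=> v; split=> -[c ->]; first by exists (c *m U); rewrite mulmxA.
  by exists (c *m invmx U); rewrite -mulmxA mulKmx.
- split=> j; have := w0 j; rewrite wd !mxE.
    move: (\sum_(_ < _) _) => x; case: (sgrP d) dn0 => //; nia.
  by rewrite !mulf_eq0 sgr_eq0.
- right; exists i; have [->|->] := sg_neq0 dn0; [left|right].
    by rewrite scale1r.
  by rewrite scaleN1r.
Qed.

Lemma move_closed_add r n (N : 'M[int]_(r, n)) C w : move_closed N C ->
  nneg w -> w = 0 \/ (exists i, w = row i N \/ w = - row i N) ->
  forall (t : nat) x, nneg x -> C x <-> C (x + t%:Z *: w).
Proof.
move=> CN w0 wN; have nD x y : nneg x -> nneg y -> nneg (x + y).
  by move=> x0 y0 j; rewrite mxE addr_ge0.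
have C1 x : nneg x -> C x <-> C (x + w).
  move=> x0; case: wN => [->|[i [wi|wi]]]; first by rewrite addr0.
    by rewrite wi; apply: CN; rewrite // -wi; apply: nD.
  by rewrite -{1}[x](subrK (row i N)) -wi; apply: iff_sym; apply: CN;
    rewrite wi ?subrK // -wi; apply: nD.
elim=> [|t IHt] x x0; first by rewrite scale0r addr0.
rewrite intS scalerDl scale1r addrA; apply: iff_trans (C1 x x0) _.
by apply: IHt; apply: nD.
Qed.

(** A basis of L is made of a basis N of the kernel K of the projection, one
    member of which is, up to sign, a vector w > 0 on sigma, and of lifts W of
    the rows of M'. A path in the projection lifts if a large multiple of w is
    added before every step; it leads from p to some y with q - y in K, and y
    is joined to q after adding a large multiple of w to both. *)
Lemma connects_of_sigma_basis n (L : zmodClosed 'rV[int]_n) r'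
    (M' : 'M[int]_(r', #|~: sigma L|)) :
  rows_basis M' (lattice_sigma L) -> connects M' ->
  exists r (M : 'M[int]_(r, n)),
    [/\ free_rows M, forall v, v \in L <-> row_span M v & connects M].
Proof.
move=> /rows_basisP[freeM' spanM'] connM'.
have dropB x y : drop_coords (sigma L) (x - y) =
    drop_coords (sigma L) x - drop_coords (sigma L) y.
  by rewrite !drop_coordsE mulmxBl.
have dropD x y : drop_coords (sigma L) (x + y) =
    drop_coords (sigma L) x + drop_coords (sigma L) y.
  by rewrite !drop_coordsE mulmxDl.
pose K v := v \in L /\ drop_coords (sigma L) v = 0.
have subK : subgroup K.
  split; first by split; [apply: rpred0 | rewrite drop_coordsE mul0mx].
  by move=> u v [uL u0] [vL v0]; split; rewrite ?rpredB // dropB u0 v0 subrr.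
have [r [N0 [freeN0 spanN0]]] := lattice_basis subK.
have [w0 [w0L w0n w0s]] := sigma_witness L.
have [|N [w [freeN spanN [w_nneg ww0] wN]]] :=
    nneg_adapted_basis freeN0 (_ : row_span N0 w0) w0n.
  apply/spanN0; split=> //; apply/drop_coords_eq0 => i.
  by rewrite w0s negbK => /eqP.
have KN v : K v <-> row_span N v by rewrite spanN0 spanN.
have ws i : (i \in sigma L) = (w 0 i != 0) by rewrite w0s ww0.
have Kw : K w.
  apply/KN; case: wN => [->|[i [->|->]]]; first by case: (row_span_subgroup N).
    exact: row_span_row.
  by rewrite -scaleN1r; apply/(subgroupZ _ (row_span_subgroup N))/row_span_row.
have /choice[V VP] : forall i, exists u,
    u \in L /\ row i M' = drop_coords (sigma L) u.
  move=> i; have /spanM'/lattice_sigmaP[u uL ->] := row_span_row M' i.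
  by exists u.
pose W := \matrix_i V i.
have WM' : W *m drop_mx (sigma L) = M'.
  by apply/row_matrixP=> i; rewrite row_mul rowK -drop_coordsE (VP i).2.
have NL : forall c : 'rV_r, c *m N \in L.
  by move=> c; have /KN[] : row_span N (c *m N) by exists c.
have Ndrop : forall c : 'rV_r, c *m N *m drop_mx (sigma L) = 0.
  by move=> c; have /KN[_ <-] : row_span N (c *m N) by [exists c]; rewrite drop_coordsE.
have WL (c : 'rV_r') : c *m W \in L.
  apply: (subgroup_mulmx _ (zmod_subgroup L)) => i; rewrite rowK.
  by case: (VP i).
exists (r + r')%N, (col_mx N W); split.
- move=> c; rewrite -[c]hsubmxK mul_row_col => /[dup] cM.
  move=> /(congr1 (mulmx^~ (drop_mx (sigma L)))) /=.
  rewrite mulmxDl Ndrop add0r mul0mx -mulmxA WM' => /freeM' c0.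
  by move: cM; rewrite c0 mul0mx addr0 => /freeN->; rewrite row_mx0.
- move=> v; split=> [vL|[c ->]]; last first.
    by rewrite -[c]hsubmxK mul_row_col rpredD.
  have [|c vc] := (spanM' (drop_coords (sigma L) v)).1.
    by apply/lattice_sigmaP; exists v.
  have /KN[d vd] : K (v - c *m W).
    split; first by rewrite rpredB.
    by rewrite dropB vc drop_coordsE -mulmxA WM' subrr.
  by exists (row_mx d c); rewrite mul_row_col -vd subrK.
move=> C CM p q p0 q0 pqM Cp.
have CN : move_closed N C.
  by move=> x i; have := CM x (lshift r' i); rewrite rowKu.
have CW x i : nneg x -> nneg (x + V i) -> C x <-> C (x + V i).
  by have := CM x (rshift r i); rewrite rowKd rowK.
have Cw := move_closed_add CN w_nneg wN.
have wnneg t : nneg (t%:Z *: w) by move=> j; rewrite mxE mulr_ge0.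
have nD x y : nneg x -> nneg y -> nneg (x + y).
  by move=> x0 y0 j; rewrite mxE addr_ge0.
have off_nneg v : nneg (drop_coords (sigma L) v) ->
    forall i, w 0 i = 0 -> 0 <= v 0 i.
  move=> /(drop_coordsP (sigma L) (fun x => 0 <= x)) v0 i /eqP wi.
  by apply: v0; rewrite ws negbK.
have drop_nneg x : nneg x -> nneg (drop_coords (sigma L) x).
  by move=> x0; apply/(drop_coordsP (sigma L) (fun a => 0 <= a)) => i _.
have dropw t : drop_coords (sigma L) (t%:Z *: w) = 0.
  by rewrite drop_coordsE -scalemxAl -drop_coordsE Kw.2 scaler0.
have wL t : t%:Z *: w \in L.
  by apply: (subgroupZ _ (zmod_subgroup L)); case: Kw.
(* x lifts to a point joined to p and congruent to p *)
pose D x := exists y, [/\ nneg y, drop_coords (sigma L) y = x, y - p \in L & C y].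
have DM' : move_closed M' D.
  move=> x i x0 xi0; have [VL dV] := VP i.
  split=> -[y [y0 yx yL Cy]].
    have [|T /(_ _ (leqnn _)) Ty] := @nneg_mul_add _ w (y + V i) w_nneg.
      by apply: off_nneg; rewrite dropD yx -dV.
    exists (y + V i + T%:Z *: w); split=> //.
    - by rewrite !dropD dropw addr0 yx -dV.
    - by rewrite addrAC rpredD // addrAC rpredD.
    - rewrite addrAC; rewrite addrAC in Ty.
      by apply: (CW _ i _ _).1; (exact: Ty || exact: nD || by apply: (Cw _ _ _).1).
  have [|T /(_ _ (leqnn _)) Ty] := @nneg_mul_add _ w (y - V i) w_nneg.
    by apply: off_nneg; rewrite dropB yx -dV addrK.
  exists (y - V i + T%:Z *: w); split=> //.
  - by rewrite dropD dropw addr0 dropB yx -dV addrK.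
  - by rewrite addrAC rpredD // addrAC rpredB.
  - have yT : y + T%:Z *: w = y - V i + T%:Z *: w + V i.
      by rewrite [_ + V i]addrAC subrK.
    by apply: (CW _ i _ _).2; rewrite -?yT;
      (exact: Ty || exact: nD || by apply: (Cw _ _ _).1).
have [||y [y0 yq yL Cy]] :=
  connM' D DM' (drop_coords (sigma L) p) (drop_coords (sigma L) q)
    (drop_nneg p p0) (drop_nneg q q0).
- apply/spanM'/lattice_sigmaP; exists (p - q); rewrite ?dropB //.
  have [c ->] := pqM; rewrite -[c]hsubmxK mul_row_col.
  by rewrite rpredD ?NL ?WL.
- by exists p; rewrite subrr rpred0.
have /KN[c qy] : K (q - y).
  split; last by rewrite dropB yq subrr.
  have -> : q - y = - (p - q) - (y - p) by rewrite !opprB subrKA.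
  rewrite rpredB ?rpredN //; have [c ->] := pqM; rewrite -[c]hsubmxK mul_row_col.
  by rewrite rpredD ?NL ?WL.
(* y + v is joined to p, up to a multiple of w *)
pose E v := exists t : nat, nneg (y + v + t%:Z *: w) /\ C (y + v + t%:Z *: w).
have EN v i : E v <-> E (v + row i N).
  have [_ dN] : K (row i N) by apply/KN/row_span_row.
  split=> -[t [yt Cyt]].
    have [|T /(_ (t + T)%N (leq_addl _ _)) Ty] :=
        @nneg_mul_add _ w (y + v + row i N) w_nneg.
      apply: off_nneg; rewrite dropD dN addr0.
      by have := drop_nneg _ yt; rewrite dropD dropw addr0.
    exists (t + T)%N; rewrite addrA; split=> //.
    rewrite [_ + row i N + _]addrAC; rewrite [_ + row i N + _]addrAC in Ty.
    apply: (CN _ i _ _).1 => //; rewrite PoszD scalerDl addrA;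
      (exact: nD || by apply: (Cw _ _ _).1).
  rewrite addrA in yt Cyt.
  have [|T /(_ (t + T)%N (leq_addl _ _)) Ty] := @nneg_mul_add _ w (y + v) w_nneg.
    apply: off_nneg; have := drop_nneg _ yt.
    by rewrite !dropD dropw dN !addr0.
  exists (t + T)%N; split=> //.
  have yT : y + v + row i N + t%:Z *: w + T%:Z *: w =
      y + v + (t + T)%N%:Z *: w + row i N.
    by rewrite -addrA -scalerDl -PoszD addrAC.
  by apply: (CN _ i _ _).2; rewrite -?yT;
      (exact: Ty || exact: nD || by apply: (Cw _ _ _).1).
have [|t [_ Cq]] := row_span_ind EN (v := 0) c.
  by exists 0%N; rewrite scale0r !addr0.
by apply: (Cw t _ q0).2; move: Cq; rewrite add0r -qy [y + _]addrC subrK.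
Qed.

(** * Prime ideals and chains *)

Section Ideals.
Variable A : comNzRingType.

Lemma prime_ideal_of_pred (S : {pred A}) :
  idealr_closed S -> prime_idealr_closed S -> exists P : prime_idealr A, P =i S.
Proof.
move=> Si Sp.
pose P : prime_idealr A :=
  HB.pack (S : A -> bool) (isIdealr.Build A S Si) (isPrimeIdealrClosed.Build A S Sp).
by exists P.
Qed.

Lemma chain_extend (Q P : prime_idealr A) h :
  has_prime_chain Q h -> strict_sub Q P -> has_prime_chain P h.+1.
Proof.
move=> [c [cQ cS]] [QP PQ]; exists (fun i => if (i <= h)%N then c i else P).
split=> [|i]; first by rewrite ltnn.
rewrite ltnS => ih; rewrite ih; move: ih; rewrite leq_eqVlt => /predU1P[->|ih].
  rewrite ltnn; split=> [f|PS]; first by rewrite cQ => /QP.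
  by apply: PQ => f /PS; rewrite cQ.
by rewrite ih; apply: cS.
Qed.

(** If P is prime, so is the extension of P to the polynomial ring: look at the
    first coefficients of F and G that are not in P. *)
Lemma prime_coefs (P : prime_idealr A) (F G : {poly A}) :
  (forall d, (F * G)`_d \in P) ->
  (forall d, F`_d \in P) \/ (forall d, G`_d \in P).
Proof.
move=> FG; apply: contrapT => /not_orP[/existsNP exF /existsNP exG].
have {}exF : exists d, F`_d \notin P by have [d /negP] := exF; exists d.
have {}exG : exists d, G`_d \notin P by have [d /negP] := exG; exists d.
case: (ex_minnP exF) => a Fa amin; case: (ex_minnP exG) => b Gb bmin.
have lt_b : (a < (a + b).+1)%N by rewrite ltnS leq_addr.
have := FG (a + b)%N; rewrite coefM (bigD1 (Ordinal lt_b)) //= addKn.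
rewrite rpredDr ?prime_idealrM ?(negbTE Fa) ?(negbTE Gb) //.
apply: rpred_sum => i ia; rewrite prime_idealrM; apply/orP.
have [ltia|ltai|eqia] := ltngtP i a.
- by left; apply: contraT => /amin; rewrite leqNgt ltia.
- right; apply: contraT => /bmin; rewrite leqNgt ltn_subLR ?ltn_add2r ?ltai //.
  by rewrite -ltnS.
- by case/eqP: ia; apply: val_inj.
Qed.

End Ideals.

(** * Removing a variable from a prime ideal *)

Section Strip.
Variables (k : fieldType) (n : nat).
Local Notation A := {mpoly k[n]}.

(** Expansion in powers of x_i. The coefficients do not involve x_i, but are
    kept in k[x] so that a prime of k[x] applies to them directly. *)
Definition as_poly_in (i : 'I_n) : A -> {poly A} :=
  mmap (polyC \o mpolyC n (R := k))
    (fun j => if j == i then 'X else ('X_j)%:P).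

Lemma as_poly_inM i : {morph as_poly_in i : f g / f * g}.
Proof. exact: (rmorphM (mmap (polyC \o mpolyC n (R := k)) _)). Qed.

Lemma as_poly_inD i : {morph as_poly_in i : f g / f + g}.
Proof. exact: (raddfD (mmap (polyC \o mpolyC n (R := k)) _)). Qed.

Lemma as_poly_inB i : {morph as_poly_in i : f g / f - g}.
Proof. exact: (raddfB (mmap (polyC \o mpolyC n (R := k)) _)). Qed.

Lemma as_poly_in0 i : as_poly_in i 0 = 0.
Proof. exact: (raddf0 (mmap (polyC \o mpolyC n (R := k)) _)). Qed.

Definition forget (i : 'I_n) (m : 'X_{1..n}) : 'X_{1..n} :=
  [multinom if j == i then 0%N else m j | j < n].

Lemma forgetE i m j : forget i m j = if j == i then 0%N else m j.
Proof. exact: mnmE. Qed.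

Lemma as_poly_inX i m :
  as_poly_in i 'X_[m] = ('X_[forget i m])%:P * 'X^(m i).
Proof.
rewrite /as_poly_in mmapX /mmap1 (bigD1 i) //= eqxx mulrC; congr (_ * _).
rewrite mpolyXE_id [X in _ = X%:P](bigD1 i) //= forgetE eqxx expr0 mul1r rmorph_prod /=.
apply: eq_bigr => j /negbTE ji; rewrite ji forgetE ji.
by rewrite rmorphXn.
Qed.

Lemma as_poly_in_eval i f : (as_poly_in i f).['X_i] = f.
Proof.
rewrite {2}(mpolyE f) /as_poly_in /mmap horner_sum; apply: eq_bigr => m _ /=.
rewrite hornerM hornerC mul_mpolyC; congr (_ *: _).
rewrite /mmap1 [RHS]mpolyXE_id horner_prod; apply: eq_bigr => j _.
by rewrite horner_exp; case: eqP => [->|_]; rewrite ?hornerX ?hornerC.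
Qed.

(** The extension to k[x] of the trace of P on the polynomials without x_i. *)
Definition strip (P : {pred A}) (i : 'I_n) : {pred A} :=
  [pred f | `[< forall d, (as_poly_in i f)`_d \in P >]].

Lemma strip_sub (P : prime_idealr A) i : {subset strip P i <= P}.
Proof.
move=> f /asboolP Pf; rewrite -(as_poly_in_eval i f) horner_coef.
by apply: rpred_sum => d _; rewrite prime_idealrM Pf.
Qed.

Lemma strip_prime (P : prime_idealr A) i :
  exists Q : prime_idealr A, Q =i strip P i.
Proof.
apply: prime_ideal_of_pred; first split.
- by apply/asboolP=> d; rewrite as_poly_in0 coef0 rpred0.
- apply/negP => /strip_sub; by rewrite idealr1.
- move=> a f g /asboolP Pf /asboolP Pg; apply/asboolP=> d.
  rewrite as_poly_inD as_poly_inM coefD; apply: rpredD; last exact: Pg.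
  by rewrite coefM; apply: rpred_sum => e _; apply: idealMr; apply: Pf.
- move=> f g /asboolP Pfg.
  have [|Pf|Pg] := @prime_coefs _ P (as_poly_in i f) (as_poly_in i g).
  + by move=> d; rewrite -as_poly_inM.
  + by apply/orP; left; apply/asboolP.
  + by apply/orP; right; apply/asboolP.
Qed.

Lemma prime_monomial (P : prime_idealr A) m :
  'X_[m] \in P -> exists i, 'X_i \in P.
Proof.
rewrite mpolyXE_id => Pm; apply: contrapT => noX; move: Pm; apply/negP.
apply: (big_ind (fun f => f \notin P)); first by rewrite idealr1.
  by move=> f g Pf Pg; rewrite prime_idealrM negb_or Pf.
move=> i _; elim: (m i) => [|d IHd]; first by rewrite expr0 idealr1.
rewrite exprS prime_idealrM negb_or IHd andbT.
by apply/negP => Xi; apply: noX; exists i.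
Qed.

Lemma strip_variable (P : prime_idealr A) i : 'X_i \notin strip P i.
Proof.
apply/negP => /asboolP/(_ 1%N); rewrite as_poly_inX coefCM coefXn mnm1E eqxx mulr1.
rewrite (_ : forget i U_(i) = 0%MM) ?mpolyX0 ?idealr1 //.
by apply/mnmP=> j; rewrite forgetE mnm0E mnm1E eq_sym; case: eqP.
Qed.

Lemma strip_binomial (P : prime_idealr A) i (a b : 'X_{1..n}) :
  a i = b i -> 'X_[forget i a] - 'X_[forget i b] \in P ->
  'X_[a] - 'X_[b] \in strip P i.
Proof.
move=> ab Pab; apply/asboolP=> d.
rewrite as_poly_inB !as_poly_inX ab -mulrBl -polyCB coefCM.
by rewrite prime_idealrM Pab.
Qed.

(** The constant coefficient with respect to x_i is a monomial, up to sign, and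
    a prime without variables contains no monomial. *)
Lemma strip_strict (P : prime_idealr A) i (a b : 'X_{1..n}) :
  (forall j, 'X_j \notin P) -> (a i > 0)%N -> b i = 0%N ->
  'X_[a] - 'X_[b] \notin strip P i.
Proof.
move=> PX ai bi; apply/negP => /asboolP/(_ 0%N).
rewrite as_poly_inB !as_poly_inX coefB !coefCM !coefXn bi [0%N == a i]eq_sym.
rewrite eqn0Ngt ai mulr0 mulr1 sub0r rpredN => /prime_monomial[j].
by apply/negP/PX.
Qed.
End Strip.

(** * Long chains below a prime that contains a lattice ideal *)

(** One step of fraction-free Gaussian elimination; if the column i is zero,
    dropping any row will do. *)
Lemma free_rows_eliminate r n (M : 'M[int]_(r.+1, n)) (i : 'I_n) :
  free_rows M -> exists M' : 'M[int]_(r, n),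
    free_rows M' /\ forall v, row_span M' v -> row_span M v /\ v 0 i = 0.
Proof.
move=> freeM; have [[p Mp]|Mi0] := pselect (exists p, M p i != 0).
  pose col := \col_a M (lift p a) i.
  pose M' := M p i *: rowsub (lift p) M - col *m row p M.
  have M'M (c : 'rV_r) : exists2 c' : 'rV_r.+1, c *m M' = c' *m M &
      forall a, c' 0 (lift p a) = M p i * c 0 a.
    have [d [dc dM]] := row_extension c (@lift_inj _ p).
    exists (M p i *: d - c *m col *m delta_mx 0 p).
      rewrite mulmxBl mulmxBr -scalemxAl dM -scalemxAr; congr (_ - _).
      by rewrite -!mulmxA -rowE.
    move=> a; rewrite [LHS]mxE mxE dc [X in _ + X]mxE [X in _ - X]mxE.
    rewrite big_ord1 !mxE eqxx /= eq_sym (negbTE (neq_lift p a)).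
    by rewrite mulr0 subr0.
  exists M'; split=> [c cM'|_ [c ->]].
    have [c' c'M c'c] := M'M c; rewrite c'M in cM'.
    apply/rowP=> a; have := c'c a; rewrite (freeM _ cM') !mxE => /esym/eqP.
    by rewrite mulf_eq0 (negbTE Mp) => /eqP.
  split; first by have [c' -> _] := M'M c; exists c'.
  rewrite mxE big1 // => a _; rewrite !mxE big_ord1 !mxE.
  by rewrite [M p i * _]mulrC subrr mulr0.
have Mi p : M p i = 0 by apply/eqP; apply: contra_notT Mi0 => Mp; exists p.
exists (rowsub (lift ord0) M); split=> [c cM|_ [c ->]].
  have [d [dc dM]] := row_extension c (@lift_inj _ ord0).
  by apply/rowP=> a; rewrite -dc (freeM d) ?mxE // dM.
split; last by rewrite mxE big1 // => a _; rewrite mxE Mi mulr0.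
have [d [_ dM]] := row_extension c (@lift_inj _ ord0).
by exists d; rewrite dM.
Qed.

Section LowerBound.
Variables (k : fieldType) (n : nat).
Local Notation A := {mpoly k[n]}.

Definition row_mnm (v : 'rV[int]_n) : 'X_{1..n} := [multinom `|v 0%R i|%N | i < n].

Lemma row_mnmE v i : row_mnm v i = `|v 0%R i|%N.
Proof. exact: mnmE. Qed.

Lemma row_mnmK v : nneg v -> mnm_row (row_mnm v) = v.
Proof. by move=> v0; apply/rowP=> i; rewrite mxE row_mnmE gez0_abs. Qed.

Lemma mnm_rowK m : row_mnm (mnm_row m) = m.
Proof. by apply/mnmP=> i; rewrite row_mnmE mxE. Qed.

Lemma mnm_row_nneg (m : 'X_{1..n}) : nneg (mnm_row m).
Proof. by move=> i; rewrite mxE. Qed.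

Lemma mnm_rowD (a b : 'X_{1..n}) : mnm_row (a + b)%MM = mnm_row a + mnm_row b.
Proof. by apply/rowP=> i; rewrite !mxE mnmDE PoszD. Qed.

Definition contains_binomials (P : {pred A}) (S : 'rV[int]_n -> Prop) :=
  forall a b : 'X_{1..n}, S (mnm_row a - mnm_row b) -> 'X_[a] - 'X_[b] \in P.

Lemma strip_contains (P : prime_idealr A) i (S S' : 'rV[int]_n -> Prop) :
  (forall v, S' v -> S v /\ v 0 i = 0) -> contains_binomials P S ->
  contains_binomials (strip P i) S'.
Proof.
move=> S'S PS a b /S'S[Sab abi]; have {}abi : a i = b i.
  by move/eqP: abi; rewrite !mxE subr_eq0 => /eqP[].
apply: strip_binomial => //; apply: PS.
rewrite (_ : _ - _ = mnm_row a - mnm_row b) //; apply/rowP=> j; rewrite !mxE !forgetE.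
by case: eqP => // ->; rewrite abi !subrr.
Qed.

(** If P contains a variable x_i, strip it: strictness is clear. If P contains
    no variable, choose i in the support of an element of the lattice. In both
    cases the elements of the lattice with vanishing i-th coordinate remain,
    and their lattice has rank at least r - 1 by [free_rows_eliminate]. *)
Lemma prime_chain_of_lattice r (M : 'M[int]_(r, n)) (P : prime_idealr A) :
  free_rows M -> contains_binomials P (row_span M) -> has_prime_chain P r.
Proof.
elim: r => [|r IHr] in M P * => freeM PM; first by exists (fun=> P).
suff [i Pi] : exists i, ~ {subset P <= strip P i}.
  have [M' [freeM' M'M]] := free_rows_eliminate i freeM.
  have [Q QP] := strip_prime P i.
  apply: (@chain_extend _ Q).
    apply: (IHr M') => // a b /(strip_contains M'M PM).
    by rewrite QP.
  split=> f; first by rewrite QP => /strip_sub.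
  by apply: Pi => g /f; rewrite QP.
have [[i Pi]|noX] := pselect (exists i, 'X_i \in P).
  by exists i => /(_ _ Pi); apply/negP/strip_variable.
have PX j : 'X_j \notin P by apply/negP=> Pj; apply: noX; exists j.
have [u uM [i ui]] : exists2 u, row_span M u & exists i, 0 < u 0 i.
  pose u := row 0 M; have uM : row_span M u by apply: row_span_row.
  have /rV0Pn[i ui] : u != 0.
    apply/eqP=> u0; have d0 : delta_mx 0 0 = 0 :> 'rV[int]_r.+1.
      by apply: freeM; rewrite -rowE.
    by have /eqP := congr1 (fun d : 'rV_r.+1 => d 0 0) d0; rewrite !mxE.
  have [ui0|ui0] := ltrP 0 (u 0 i); first by exists u => //; exists i.
  exists (- u); first by rewrite -scaleN1r; apply/(subgroupZ _ (row_span_subgroup M)).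
  by exists i; rewrite mxE oppr_gt0 lt_neqAle ui.
exists i => Pstrip.
have := @strip_strict _ _ P i (row_mnm (pos_part u)) (row_mnm (pos_part (- u))) PX.
rewrite !row_mnmE !mxE => /(_ _ _)/negP; apply; last first.
- by apply/Pstrip/PM; rewrite !row_mnmK ?pos_part_sub //; apply: pos_part_nneg.
- by rewrite max_l // oppr_le0 ltW.
- by rewrite max_r ?ltW // absz_gt0 gt_eqF.
Qed.

End LowerBound.

(** * Primes avoiding a multiplicative set and sums over classes *)

Section Avoidance.
Variables (A : comNzRingType) (I S : A -> Prop).
Hypothesis I0 : I 0.
Hypothesis IM : forall a f g, I f -> I g -> I (a * f + g).
Hypothesis S1 : S 1.
Hypothesis SM : forall f g, S f -> S g -> S (f * g).
Hypothesis IS : forall f, I f -> ~ S f.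

Let avoiding (J : A -> Prop) :=
  [/\ forall a f g, J f -> J g -> J (a * f + g),
      forall f, I f -> J f & forall f, J f -> ~ S f].

(** Krull: an ideal containing I that is maximal among those disjoint from the
    multiplicative set S is prime. *)
Lemma prime_avoiding :
  exists P : prime_idealr A, (forall f, I f -> f \in P) /\
    (forall f, f \in P -> ~ S f).
Proof.
have [|J [JP Jmax]] :=
    (* the empty set is let in for the sake of the empty chain *)
    @classical_sets.Zorn_bigcup A (fun J => (forall f, ~ J f) \/ avoiding J).
  move=> F FP Ftot.
  have [[X [FX [f Xf]]]|F0] := pselect (exists X, F X /\ exists f, X f); last first.
    by left=> f [X FX Xf]; apply: F0; exists X; split => //; exists f.
  have FG Y g : F Y -> Y g -> avoiding Y by move=> /FP[Y0 /Y0|].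
  right; split=> [a g h [Y FY Yg] [Z FZ Zh]|g Ig|g [Y FY Yg]].
  - have [YZ|ZY] := Ftot _ _ FY FZ.
      by exists Z => //; have [ZM _ _] := FG _ _ FZ Zh; apply: ZM => //; apply: YZ.
    by exists Y => //; have [YM _ _] := FG _ _ FY Yg; apply: YM => //; apply: ZY.
  - by exists X => //; have [_ IX _] := FG _ _ FX Xf; apply: IX.
  - by have [_ _] := FG _ _ FY Yg; apply.
have good : avoiding J.
  case: JP => // J0; exfalso; apply: (Jmax I); last by right; split.
  by split=> [f /J0 //|/(_ _ I0)/J0].
have [JM IJ JS] := good.
have J0 : J 0 by apply: IJ.
have Jl a f : J f -> J (a * f) by move=> Jf; rewrite -[_ * _]addr0; apply: JM.
have JD f g : J f -> J g -> J (f + g) by move=> Jf Jg; rewrite -[f]mul1r; apply: JM.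
have grow u : ~ J u -> exists a j, J j /\ S (a * u + j).
  move=> Ju; apply: contrapT => noS.
  apply: (Jmax (fun f => exists a j, J j /\ f = a * u + j)).
    split=> [f Jf|]; first by exists 0, f; rewrite mul0r add0r.
    by move/(_ u) => uJ; apply/Ju/uJ; exists 1, 0; rewrite mul1r addr0.
  right; split=> [b f g [a1 [j1 [Jj1 ->]]] [a2 [j2 [Jj2 ->]]]|f If|f].
  - by exists (b * a1 + a2), (b * j1 + j2); split; [apply: JM | ring].
  - by exists 0, f; rewrite mul0r add0r; split=> //; apply: IJ.
  - by move=> [a [j [Jj ->]]] Sf; apply: noS; exists a, j.
have [||P PJ] := @prime_ideal_of_pred A (fun f => `[< J f >]).
- split; first exact/asboolP.
    by apply/negP => /asboolP/JS/(_ S1).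
  by move=> a f g /asboolP Jf /asboolP Jg; apply/asboolP/JM.
- move=> u v /asboolP Juv; apply: contrapT => /negP/norP[/asboolP Ju /asboolP Jv].
  have [a [j [Jj Sa]]] := grow u Ju; have [b [l [Jl' Sb]]] := grow v Jv.
  apply: (JS _ _ (SM Sa Sb)).
  have -> : (a * u + j) * (b * v + l) =
      (a * b) * (u * v) + ((a * u) * l + (b * v + l) * j) by ring.
  by apply: JM => //; apply: JD; apply: Jl.
exists P; split=> f; first by move=> If; rewrite PJ; apply/asboolP/IJ.
by rewrite PJ => /asboolP/JS.
Qed.

End Avoidance.

Section ClassSum.
Variables (k : fieldType) (n : nat).
Local Notation A := {mpoly k[n]}.

(** Linear extension to polynomials of the indicator function of a set of
    exponents. *)
Definition class_sum (C : 'X_{1..n} -> bool) (f : A) : k :=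
  \sum_(m <- msupp f) f@_m * (C m)%:R.

Lemma class_sumE C f d : (msize f <= d)%N ->
  class_sum C f = \sum_(m : 'X_{1..n < d}) f@_m * (C m)%:R.
Proof.
move=> fd; pose I : subFinType _ := 'X_{1..n < d}.
rewrite /class_sum (big_mksub I) ?msupp_uniq //=; first last.
  by move=> x /msize_mdeg_lt /leq_trans; apply.
by rewrite big_rmcond //= => j /memN_msupp_eq0 ->; rewrite mul0r.
Qed.

Lemma class_sum_linear C a f g :
  class_sum C (a *: f + g) = a * class_sum C f + class_sum C g.
Proof.
pose d := maxn (msize (a *: f + g)) (maxn (msize f) (msize g)).
rewrite !(@class_sumE C _ d) ?leq_max ?leqnn ?orbT // mulr_sumr -big_split /=.
by apply: eq_bigr => m _; rewrite mcoeffD mcoeffZ mulrDl mulrA.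
Qed.

Lemma class_sum0 C : class_sum C 0 = 0.
Proof. by rewrite /class_sum msupp0 big_nil. Qed.

Lemma class_sumX C m : class_sum C 'X_[m] = (C m)%:R.
Proof. by rewrite /class_sum msuppX big_seq1 mcoeffX eqxx mul1r. Qed.

Lemma class_sumD C f g : class_sum C (f + g) = class_sum C f + class_sum C g.
Proof. by rewrite -[f in LHS]scale1r class_sum_linear mul1r. Qed.

Lemma class_sumB C a b :
  class_sum C ('X_[a] - 'X_[b]) = (C a)%:R - (C b)%:R.
Proof.
by rewrite addrC -scaleN1r class_sum_linear !class_sumX mulN1r addrC.
Qed.

(** The functional vanishes on every monomial multiple of a generator, whose
    two monomials are both in C or both outside. *)
Lemma class_sum_ideal C (S : A -> Prop) :
  (forall f, S f -> exists a b, f = 'X_[a] - 'X_[b] /\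
    forall c, C (c + a)%MM = C (c + b)%MM) ->
  forall f, f \in ideal_gen S -> class_sum C f = 0.
Proof.
move=> SC f /asboolP[s [Ss ->]]; rewrite big_seq.
elim/big_rec: _ => [|[g b] h /Ss/SC[a [c [bE Cac]]] h0]; first exact: class_sum0.
rewrite /= in bE; rewrite class_sumD h0 addr0 /= {}bE {h h0 Ss}.
rewrite (mpolyE g) mulr_suml; elim/big_rec: _ => [|m h _ h0]; first exact: class_sum0.
rewrite -scalerAl class_sum_linear h0 addr0 mulrBr -!mpolyXD class_sumB Cac.
by rewrite subrr mulr0.
Qed.

Lemma class_of_binomial (C : 'X_{1..n} -> bool) (S : A -> Prop) (a b : 'X_{1..n}) :
  (forall f, S f -> exists a b : 'X_{1..n}, f = 'X_[a] - 'X_[b] /\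
    forall c, C (c + a)%MM = C (c + b)%MM) ->
  'X_[a] - 'X_[b] \in ideal_gen S -> C a = C b.
Proof.
move=> SC /(class_sum_ideal SC); rewrite class_sumB.
by case: (C a); case: (C b) => // /eqP; rewrite ?subr0 ?sub0r ?oppr_eq0 oner_eq0.
Qed.

End ClassSum.

(** * Chains of primes are bounded by growth *)

Section UpperBound.
Variables (k : fieldType) (n : nat).
Local Notation A := {mpoly k[n]}.

Definition independent_mod (P : {pred A}) (J : finType) (B : J -> A) :=
  forall c : J -> k, \sum_j c j *: B j \in P -> forall j, c j = 0.

Definition degree_le (d : nat) (f : A) := forall m, m \in msupp f -> (mdeg m <= d)%N.

Lemma degree_leM d e f g :
  degree_le d f -> degree_le e g -> degree_le (d + e) (f * g).
Proof.
move=> df eg m /msuppM_le /allpairsP[[a b] /= [af bg ->]].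
by rewrite mdegD leq_add ?df ?eg.
Qed.

Lemma degree_leX d f e : degree_le d f -> degree_le (d * e) (f ^+ e).
Proof.
move=> df; elim: e => [|e IHe]; last by rewrite exprS mulnS; apply: degree_leM.
by move=> m; rewrite msupp1 inE => /eqP->; rewrite mdeg0.
Qed.

Lemma degree_leW d e f : (d <= e)%N -> degree_le d f -> degree_le e f.
Proof. by move=> de df m /df /leq_trans; apply. Qed.

(** There are at most (d+1)^n monomials of degree at most d. *)
Lemma independent_card (P : prime_idealr A) (J : finType) (B : J -> A) d :
  independent_mod P B -> (forall j, degree_le d (B j)) ->
  (#|J| <= d.+1 ^ n)%N.
Proof.
move=> indB degB; pose E : finType := {ffun 'I_n -> 'I_d.+1}.
have <- : #|E| = (d.+1 ^ n)%N by rewrite card_ffun !card_ord.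
rewrite leqNgt; apply/negP => EJ.
pose mon (e : E) : 'X_{1..n} := [multinom e i : nat | i < n].
pose M : 'M[k]_(#|J|, #|E|) :=
  \matrix_(a, b) (B (enum_val a))@_(mon (enum_val b)).
have : kermx M != 0.
  rewrite kermx_eq0 /row_free neq_ltn; apply/orP; left.
  exact: leq_ltn_trans (rank_leq_col M) EJ.
case/rowV0Pn => v /sub_kermxP vM v0.
pose c j := v 0 (enum_rank j).
have c0 : \sum_j c j *: B j = 0.
  apply/mpolyP=> m; rewrite mcoeff0 raddf_sum /=.
  have [md|md] := leqP (mdeg m) d; last first.
    rewrite big1 // => j _; rewrite mcoeffZ memN_msupp_eq0 ?mulr0 //.
    by apply/negP => /degB; rewrite leqNgt md.
  have mE : exists e : E, mon e = m.
    have mi i : (m i < d.+1)%N.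
      by rewrite ltnS (leq_trans _ md) // mdegE (bigD1 i) //= leq_addr.
    exists [ffun i => Ordinal (mi i)]; apply/mnmP=> i.
    by rewrite mnmE ffunE.
  have [e <-] := mE; move/rowP/(_ (enum_rank e)): vM; rewrite !mxE => vMe.
  rewrite -[RHS]vMe (reindex _ (onW_bij _ (enum_val_bij J))) /=.
  by apply: eq_bigr => a _; rewrite mcoeffZ mxE enum_rankK /c enum_valK.
have {}c0 : forall j, c j = 0 by apply: indB; rewrite c0 rpred0.
case/eqP: v0; apply/rowP=> a; have := c0 (enum_val a).
by rewrite /c enum_valK mxE.
Qed.

(** Modulo P only the term d = 0 remains, so G 0 vanishes; as f is not in Q,
    one factor f can then be cancelled. *)
Lemma power_combination_eq0 (Q P : prime_idealr A) f N (G : nat -> A) :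
  {subset Q <= P} -> f \in P -> f \notin Q ->
  (forall d, G d \in P -> G d = 0) ->
  \sum_(d < N) f ^+ d * G d \in Q -> forall d, (d < N)%N -> G d = 0.
Proof.
move=> QP fP fQ; elim: N G => // N IHN G GP; rewrite big_ord_recl expr0 mul1r => sumQ.
have G0 : G 0%N = 0.
  apply: GP; move/QP: sumQ; rewrite rpredDr //; apply: rpred_sum => d _.
  by rewrite exprS -mulrA prime_idealrM fP.
move: sumQ; rewrite G0 add0r => sumQ; case=> [//|d]; rewrite ltnS.
apply: (IHN (fun d => G d.+1)) => [e|]; first exact: GP.
move: sumQ; rewrite (eq_bigr (fun d : 'I_N => f * (f ^+ d * G d.+1))).
  by rewrite -mulr_sumr prime_idealrM (negbTE fQ).
by move=> e _; rewrite lift0 exprS mulrA.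
Qed.

Lemma independent_step (Q P : prime_idealr A) f N (J : finType) (B : J -> A) :
  {subset Q <= P} -> f \in P -> f \notin Q -> independent_mod P B ->
  independent_mod Q (fun x : 'I_N * J => f ^+ x.1 * B x.2).
Proof.
move=> QP fP fQ indB c cQ.
pose G d := \sum_j (if insub d is Some d' then c (d', j) else 0) *: B j.
have GP d : G d \in P -> G d = 0.
  by move=> /indB Gd; rewrite /G big1 // => j _; rewrite Gd scale0r.
have Gval (d : 'I_N) : G d = \sum_j c (d, j) *: B j.
  by rewrite /G; apply: eq_bigr => j _; rewrite valK.
suff G0 : forall d, (d < N)%N -> G d = 0.
  move=> [d j]; have /indB/(_ j) // : \sum_j c (d, j) *: B j \in P.
  by rewrite -Gval G0 ?rpred0.
have {cQ Gval} : \sum_(d < N) f ^+ d * G d \in Q.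
  rewrite (eq_bigr (fun d : 'I_N => \sum_j c (d, j) *: (f ^+ d * B j))).
    rewrite pair_big /= (eq_bigr (fun x => c x *: (f ^+ x.1 * B x.2))) //.
    by case.
  move=> d _; rewrite Gval mulr_sumr; apply: eq_bigr => j _.
  by rewrite scalerAr.
by move=> sumQ; apply: (power_combination_eq0 QP fP fQ GP sumQ).
Qed.

(** The number of polynomials of degree O(N) that are linearly independent
    modulo P grows at least like N^e: a lower bound e for the dimension of
    k[x]/P, which avoids transcendence degrees. *)
Definition growth_ge (P : {pred A}) e := exists D, forall N,
  exists (J : finType) (B : J -> A),
    [/\ #|J| = (N ^ e)%N, independent_mod P B & forall j, degree_le (D * N) (B j)].

Lemma growth_le (P : prime_idealr A) e : growth_ge P e -> (e <= n)%N.
Proof.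
move=> [D DP]; rewrite leqNgt; apply/negP => ne.
(* N^n.+1 outgrows (D * N + 1)^n <= (D.+1)^n * N^n *)
pose N := ((D.+1) ^ n).+1; have [J [B [cardJ indB degB]]] := DP N.
have := independent_card indB degB; rewrite cardJ leqNgt => /negP; apply.
apply: (@leq_trans (N ^ n.+1)); last exact: leq_pexp2l.
apply: (@leq_ltn_trans ((D.+1 * N) ^ n)).
  have [->|n0] := posnP n; first by rewrite !expn0.
  by rewrite leq_exp2r // mulSn -add1n leq_add2r.
by rewrite expnMn expnSr mulnC ltn_pmul2l ?expn_gt0.
Qed.

(** Each step down from P to Q gains one dimension, by the powers f^d, d < N,
    of an element f of P outside Q. *)
Lemma growth_chain (P : prime_idealr A) e h :
  growth_ge P e -> has_prime_chain P h -> exists Q : prime_idealr A, growth_ge Q (e + h).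
Proof.
elim: h P e => [|h IHh] P e Pe; first by exists P; rewrite addn0.
move=> [c [cP cS]]; have [cc Pc] := cS h (ltnSn h).
have {cc} cc : {subset c h <= P} by move=> f /cc; rewrite cP.
have {Pc} [f fP fc] : exists2 f, f \in P & f \notin c h.
  apply: contrapT => nof; apply: Pc => f; rewrite cP => fP.
  by apply: contrapT => /negP fc; apply: nof; exists f.
rewrite addnS -addSn; apply: (IHh (c h)); last first.
  by exists c; split=> // i ih; apply: cS; rewrite ltnS ltnW.
have [D DP] := Pe; exists (msize f + D)%N => N.
have [J [B [cardJ indB degB]]] := DP N.
exists ('I_N * J)%type, (fun x : 'I_N * J => f ^+ x.1 * B x.2); split.
- by rewrite card_prod card_ord cardJ expnS.
- exact: (independent_step cc fP fc indB).
move=> [d j] /=; rewrite mulnDl; apply: degree_leM => //.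
apply: (@degree_leW (msize f * d)); first by rewrite leq_mul2l ltnW ?orbT.
by apply: degree_leX => m /msize_mdeg_lt /ltnW.
Qed.

End UpperBound.

(** * Lattice ideals and independent monomials *)

(** A maximal nonsingular minor over the rationals. *)
Lemma pivot_columns r n (M : 'M[int]_(r, n)) : free_rows M ->
  exists2 f : 'I_r -> 'I_n, injective f &
    forall c : 'rV[int]_r, (forall a, (c *m M) 0 (f a) = 0) -> c = 0.
Proof.
move=> freeM; pose Mq : 'M[rat]_(r, n) := map_mx intr M.
have freeMq : row_free Mq.
  by apply: contraT => /int_dependency[c /eqP c0 /freeM].
have fullMq : row_full Mq^T by rewrite /row_full mxrank_tr.
exists (fullrankfun fullMq); first exact: fullrankfun_inj.
move=> c cM; have cMq : map_mx intr c *m (rowsub (fullrankfun fullMq) Mq^T)^T = 0.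
  apply/rowP=> a; have := congr1 (fun x : int => x%:~R : rat) (cM a).
  rewrite !mxE raddf_sum /= => e0; rewrite -[RHS]e0; apply: eq_bigr => i _.
  by rewrite !mxE rmorphM.
apply/rowP=> i; apply: (@intr_inj rat).
have /rowP/(_ i) : map_mx intr c = 0 :> 'rV[rat]_r.
  have := fullrowsub_unit fullMq; rewrite -unitmx_tr => Uunit.
  by rewrite -[map_mx _ _]mulmx1 -(mulmxV Uunit) mulmxA cMq mul0mx.
by rewrite !mxE.
Qed.

Section Height.
Variables (k : fieldType) (n : nat).
Local Notation A := {mpoly k[n]}.

Lemma ideal_gen0 (S : A -> Prop) : 0 \in ideal_gen S.
Proof. by apply/asboolP; exists [::]; rewrite big_nil. Qed.

Lemma ideal_genM (S : A -> Prop) a f g :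
  f \in ideal_gen S -> g \in ideal_gen S -> a * f + g \in ideal_gen S.
Proof.
move=> /asboolP[s [Ss ->]] /asboolP[t [St ->]]; apply/asboolP.
exists ([seq (a * x.1, x.2) | x <- s] ++ t); split=> [x|].
  by rewrite mem_cat => /orP[/mapP[y /Ss Sy ->]|/St].
rewrite big_cat big_map mulr_sumr; congr (_ + _).
by apply: eq_bigr => x _; rewrite mulrA.
Qed.

Lemma ideal_gen_mem (S : A -> Prop) f : S f -> f \in ideal_gen S.
Proof.
move=> Sf; apply/asboolP; exists [:: (1, f)]; rewrite big_seq1 mul1r.
by split=> // x; rewrite inE => /eqP->.
Qed.

Lemma ideal_gen_min (S T : A -> Prop) :
  (forall f, S f -> f \in ideal_gen T) -> {subset ideal_gen S <= ideal_gen T}.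
Proof.
move=> ST f /asboolP[s [Ss ->]]; rewrite big_seq.
elim/big_rec: _ => [|x g /Ss/ST xT gT]; first exact: ideal_gen0.
exact: ideal_genM.
Qed.

(** The hypothesis says that P contains no nonzero polynomial in the variables
    x_(g a): the monomials in these variables are independent modulo P. *)
Lemma growth_of_monomials (P : {pred A}) t (g : 'I_t -> 'I_n) : injective g ->
  (forall f, f \in P ->
    (forall m, m \in msupp f -> forall i, (forall a, g a != i) -> m i = 0%N) ->
    f = 0) ->
  growth_ge P t.
Proof.
move=> injg P0; exists t => N.
pose mon (e : {ffun 'I_t -> 'I_N}) : 'X_{1..n} := (\sum_a U_(g a) *+ e a)%MM.
have monE e a : mon e (g a) = e a.
  rewrite mnm_sumE (bigD1 a) //= mulmnE mnm1E eqxx mul1n big1 ?addn0 // => b ba.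
  by rewrite mulmnE mnm1E (inj_eq injg) (negbTE ba) mul0n.
have monI : injective mon.
  by move=> e e' ee'; apply/ffunP=> a; apply: val_inj; rewrite /= -!monE ee'.
exists {ffun 'I_t -> 'I_N}, (fun e => 'X_[mon e]); split.
- by rewrite card_ffun !card_ord.
- move=> c cP e; have c0 : \sum_e c e *: 'X_[mon e] = 0 :> A.
    apply: P0 cP _ => m /msupp_sum_le /flatten_mapP[e' _].
    move=> /msuppZ_le; rewrite msuppX inE => /eqP-> i gi.
    rewrite mnm_sumE big1 // => a _.
    by rewrite mulmnE mnm1E (negbTE (gi a)) mul0n.
  have := congr1 (mcoeff (mon e)) c0; rewrite mcoeff0 raddf_sum (bigD1 e) //=.
  rewrite mcoeffZ mcoeffX eqxx mulr1 big1 ?addr0 // => e' ee'.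
  by rewrite mcoeffZ mcoeffX (inj_eq monI) (negbTE ee') mulr0.
- move=> e m; rewrite msuppX inE => /eqP->; rewrite mdeg_sum.
  apply: (@leq_trans (\sum_(a < t) N)); last by rewrite sum_nat_const card_ord.
  by apply: leq_sum => a _; rewrite mdegMn mdeg1 mul1n ltnW.
Qed.

Lemma lattice_class_shift (L : zmodClosed 'rV[int]_n) (m u v c : 'X_{1..n}) :
  mnm_row u - mnm_row v \in L ->
  (mnm_row m - mnm_row (c + u)%MM \in L) = (mnm_row m - mnm_row (c + v)%MM \in L).
Proof.
move=> uvL; rewrite -(rpredDr (mnm_row m - mnm_row (c + u)%MM) uvL).
by congr (_ \in L); apply/rowP=> i; rewrite !mnm_rowD !mxE; ring.
Qed.

Lemma lattice_ideal_binomial (L : zmodClosed 'rV[int]_n) (a b : 'X_{1..n}) :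
  'X_[a] - 'X_[b] \in lattice_ideal k L <-> mnm_row a - mnm_row b \in L.
Proof.
split=> [abI|abL]; last by apply: ideal_gen_mem; exists a, b.
pose C m := mnm_row a - mnm_row m \in L.
suff : C a = C b by rewrite {1}/C subrr rpred0.
apply: (class_of_binomial _ abI) => _ [u [v [uvL ->]]]; exists u, v; split=> // c.
exact: lattice_class_shift.
Qed.

(** If no nonzero element of L vanishes on Z, distinct monomials without
    variables from Z lie in distinct classes modulo L, so each coefficient of f
    is the sum of the coefficients over a class, hence zero. *)
Lemma lattice_ideal_no_free (L : zmodClosed 'rV[int]_n) (Z : pred 'I_n) f :
  (forall v, v \in L -> (forall i, Z i -> v 0 i = 0) -> v = 0) ->
  f \in lattice_ideal k L ->
  (forall m, m \in msupp f -> forall i, Z i -> m i = 0%N) -> f = 0.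
Proof.
move=> LZ fL fZ; apply/eqP; apply: contraT => f0.
have [m0 m0f] : exists m, m \in msupp f by exists (mlead f); apply: mlead_supp.
pose C m := mnm_row m0 - mnm_row m \in L.
have : class_sum C f = 0.
  apply: class_sum_ideal fL => _ [u [v [uvL ->]]]; exists u, v; split=> // c.
  exact: lattice_class_shift.
rewrite /class_sum (bigD1_seq m0) //= /C subrr rpred0 mulr1 big_seq_cond big1.
  by move=> /eqP; rewrite addr0 mcoeff_eq0 m0f.
move=> m /andP[mf mm0]; case: (boolP (_ \in L)) => [mL|]; last by rewrite mulr0.
case/eqP: mm0; rewrite -[m]mnm_rowK -[m0]mnm_rowK; congr row_mnm.
apply/esym/eqP; rewrite -subr_eq0; apply/eqP/LZ => // i Zi.
by rewrite !mxE !fZ // subrr.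
Qed.

End Height.

(** * Height and generators of lattice ideals *)

Section Main.
Variables (k : fieldType) (n : nat).
Local Notation A := {mpoly k[n]}.

(** A prime above I_L that contains no nonzero polynomial in the n - r
    variables off the pivot columns of M has growth at least n - r, and a chain
    of length h below it would end in a prime of growth at least n - r + h. *)
Lemma lattice_prime_bound (L : zmodClosed 'rV[int]_n) r (M : 'M[int]_(r, n)) :
  free_rows M -> (forall v, v \in L <-> row_span M v) ->
  exists P : prime_idealr A, {subset lattice_ideal k L <= P} /\
    forall h, has_prime_chain P h -> (h <= r)%N.
Proof.
move=> freeM LM; have [f injf fM] := pivot_columns freeM.
pose Z := f @: setT; have cardZ : #|Z| = r by rewrite card_imset // cardsT card_ord.
pose S (g : A) := g != 0 /\
  forall m, m \in msupp g -> forall i, i \in Z -> m i = 0%N.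
have LZ v : v \in L -> (forall i, i \in Z -> v 0 i = 0) -> v = 0.
  move=> /LM[c ->] vZ; rewrite (fM c) ?mul0mx // => a.
  by apply: vZ; apply: imset_f.
have [|||||P [LP PS]] := @prime_avoiding A (fun g => g \in lattice_ideal k L) S.
- exact: ideal_gen0.
- exact: ideal_genM.
- split; first exact: oner_neq0.
  by move=> m; rewrite msupp1 inE => /eqP-> i _; rewrite mnm0E.
- move=> g h [g0 gZ] [h0 hZ]; split; first by rewrite mulf_neq0.
  move=> m /msuppM_le/allpairsP[[a b] /= [ag bh ->]] i iZ.
  by rewrite mnmDE (gZ a) // (hZ b).
- move=> g gL [g0 gZ]; case/eqP: g0.
  exact: (lattice_ideal_no_free (Z := mem Z) LZ gL gZ).
exists P; split=> // h Ph.
have grP : growth_ge P #|~: Z|.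
  apply: (@growth_of_monomials _ _ _ _ enum_val) => [|g gP gZ].
    exact: enum_val_inj.
  apply/eqP; apply: contraT => g0; case: (PS g gP); split=> // m mg i iZ.
  apply: (gZ m mg) => a; apply: contraTneq iZ => <-.
  by have := enum_valP a; rewrite inE.
have [Q /growth_le] := growth_chain grP Ph.
have := cardsC Z; rewrite cardZ card_ord => Zn.
by move=> Zh; rewrite -(leq_add2l #|~: Z|) [leqRHS]addnC Zn.
Qed.

Lemma lattice_ideal_height (L : zmodClosed 'rV[int]_n) r (M : 'M[int]_(r, n)) :
  free_rows M -> (forall v, v \in L <-> row_span M v) ->
  is_height (lattice_ideal k L) r.
Proof.
move=> freeM LM; have chain (P : prime_idealr A) :
    {subset lattice_ideal k L <= P} -> has_prime_chain P r.
  move=> LP; apply: (prime_chain_of_lattice freeM) => a b /LM abL.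
  by apply/LP/lattice_ideal_binomial.
split=> [|P h LP [_]]; last by apply; apply: chain.
have [P [LP Pr]] := lattice_prime_bound freeM LM.
by exists P; split=> //; split=> //; apply: chain.
Qed.

Lemma is_height_unique (I : {pred A}) r r' :
  is_height I r -> is_height I r' -> r = r'.
Proof.
move=> [[P [IP Pr]] rmin] [[P' [IP' Pr']] r'min].
by apply/eqP; rewrite eqn_leq (rmin P') // (r'min P).
Qed.

(** The generators are the binomials x^u - x^v with u and v the positive and
    negative parts of the rows of M. The exponents congruent to b modulo the
    ideal they generate are closed under the moves. *)
Lemma complete_intersection_of_connects (L : zmodClosed 'rV[int]_n) r
    (M : 'M[int]_(r, n)) :
  free_rows M -> (forall v, v \in L <-> row_span M v) -> connects M ->
  binomial_complete_intersection (lattice_ideal k L).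
Proof.
move=> freeM LM connM; exists r; split; first exact: lattice_ideal_height LM.
pose u i := row_mnm (pos_part (row i M)).
pose v i := row_mnm (pos_part (- row i M)).
have uvM i : mnm_row (u i) - mnm_row (v i) = row i M.
  by rewrite !row_mnmK ?pos_part_sub //; apply: pos_part_nneg.
pose B := [tuple ('X_[u i] - 'X_[v i] : A) | i < r].
have BP b : b \in B -> exists i, b = 'X_[u i] - 'X_[v i].
  by move=> /mapP[i _ ->]; exists i.
exists B; split=> [b /BP[i ->]|].
  exists (u i), (v i); split=> //; apply/eqP=> uv.
  have d0 : delta_mx 0 i = 0 :> 'rV[int]_r.
    by apply: freeM; rewrite -rowE -uvM uv subrr.
  by have /eqP := congr1 (fun d : 'rV_r => d 0 i) d0; rewrite !mxE !eqxx.
move=> f; apply/idP/idP; apply: ideal_gen_min f => f.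
  move=> [a [b [abL ->]]].
  pose C x := 'X_[row_mnm x] - 'X_[b] \in ideal_gen (fun f => f \in B).
  rewrite -{1}(mnm_rowK a) -/(C (mnm_row a)).
  apply: (connM C _ (mnm_row b) (mnm_row a)); try exact: mnm_row_nneg.
  - move=> x i x0 xi0.
    have gen : 'X_[row_mnm (x + row i M)] - 'X_[row_mnm x] \in
        ideal_gen (fun f => f \in B).
      pose c := row_mnm (x - pos_part (- row i M)).
      have c0 : nneg (x - pos_part (- row i M)).
        move=> j; have := xi0 j; rewrite mxE => xij; rewrite 3!mxE subr_ge0.
        by rewrite ge_max x0 mxE lerNl -subr_ge0 opprK addrC.
      have xc : row_mnm x = (c + v i)%MM.
        apply: (can_inj (@mnm_rowK n)); rewrite mnm_rowD !row_mnmK ?subrK //.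
        exact: pos_part_nneg.
      have xic : row_mnm (x + row i M) = (c + u i)%MM.
        apply: (can_inj (@mnm_rowK n)); rewrite mnm_rowD !row_mnmK //.
          by rewrite -{1}(pos_part_sub (row i M)) addrAC addrA addrAC.
        exact: pos_part_nneg.
      rewrite xc xic !mpolyXD -mulrBr -[_ * _]addr0.
      apply: ideal_genM (ideal_gen0 _); apply: ideal_gen_mem.
      by apply/mapP; exists i; rewrite ?mem_enum.
    rewrite /C; split=> [xb|xib].
      rewrite -(subrKA 'X_[row_mnm x]) -['X_[row_mnm (x + _)] - _]mul1r.
      exact: ideal_genM.
    rewrite -(subrKA 'X_[row_mnm (x + row i M)]) -opprB -mulN1r.
    exact: ideal_genM.
  - by apply/LM; rewrite -opprB rpredN.
  - by rewrite /C mnm_rowK subrr ideal_gen0.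
move=> /BP[i ->]; apply/lattice_ideal_binomial; rewrite uvM.
exact/LM/row_span_row.
Qed.

(** The differences of exponents of r generators are connecting, hence span L;
    since r is the rank of L, they are independent. *)
Lemma connects_of_complete_intersection (L : zmodClosed 'rV[int]_n) :
  binomial_complete_intersection (lattice_ideal k L) ->
  exists r (M : 'M[int]_(r, n)),
    [/\ free_rows M, forall v, v \in L <-> row_span M v & connects M].
Proof.
move=> [r [Lr [B [Bbin LB]]]].
have /choice[u /choice[v uvB]] : forall i, exists a b : 'X_{1..n},
    tnth B i = 'X_[a] - 'X_[b].
  by move=> i; have [a [b [_ ->]]] := Bbin _ (mem_tnth i B); exists a, b.
pose M := \matrix_i (mnm_row (u i) - mnm_row (v i)).
have BP f : f \in B -> exists i, f = 'X_[u i] - 'X_[v i].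
  by move=> /tnthP[i ->]; exists i; rewrite uvB.
have rowL i : row i M \in L.
  rewrite rowK; apply/(lattice_ideal_binomial k); rewrite LB.
  by apply: ideal_gen_mem; rewrite -uvB mem_tnth.
have connM' C : move_closed M C -> forall p q, nneg p -> nneg q ->
    p - q \in L -> C p -> C q.
  move=> CM p q p0 q0 pqL Cp; pose C' m := `[< C (mnm_row m) >].
  have : C' (row_mnm p) = C' (row_mnm q).
    apply: (@class_of_binomial k _ C' (fun f => f \in B)).
      move=> f /BP[i ->]; exists (u i), (v i); split=> // c.
      have uv : mnm_row (c + u i)%MM = mnm_row (c + v i)%MM + row i M.
        by rewrite rowK !mnm_rowD; apply/rowP=> j; rewrite !mxE; ring.
      have := CM _ i (mnm_row_nneg (c + v i)%MM); rewrite -uv.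
      by move=> /(_ (mnm_row_nneg _))[vu uv']; apply/asboolP/asboolP.
    by rewrite -LB; apply/lattice_ideal_binomial; rewrite !row_mnmK.
  by move=> CC; apply/asboolP; rewrite -(row_mnmK q0) -/(C' _) -CC; apply/asboolP;
    rewrite row_mnmK.
have LM v' : v' \in L <-> row_span M v'.
  split=> [vL|[c ->]]; last first.
    by apply: (subgroup_mulmx _ (zmod_subgroup L)).
  pose q := pos_part (- v').
  pose C x := row_span M (x - q).
  have : C (pos_part v').
    apply: (connM' C _ q); try exact: pos_part_nneg.
    - move=> x i _ _; split; rewrite /C => xM.
        rewrite addrAC; apply: subgroupD (row_span_row M i) => //.
        exact: row_span_subgroup.
      rewrite -[x](addrK (row i M)) addrAC.
      by case: (row_span_subgroup M) => _; apply=> //; apply: row_span_row.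
    - by rewrite -opprB pos_part_sub rpredN.
    - by rewrite /C subrr; case: (row_span_subgroup M).
  by rewrite /C pos_part_sub.
have [r0 [M0 [freeM0 LM0]]] := lattice_basis (zmod_subgroup L).
have rr0 : r0 = r by apply: is_height_unique Lr; apply: lattice_ideal_height LM0.
subst r0; exists r, M; split=> // [c cM|C CM p q p0 q0 /LM]; last exact: connM'.
have /choice[X XP] : forall i, exists c, row i M0 = c *m M.
  by move=> i; apply/LM/LM0/row_span_row.
have /choice[Y YP] : forall i, exists c, row i M = c *m M0.
  by move=> i; apply/LM0/LM/row_span_row.
(* the base changes X and Y are square, so XY = 1 implies YX = 1 *)
have XM : \matrix_i X i *m M = M0.
  by apply/row_matrixP=> i; rewrite row_mul rowK XP.
have YM : \matrix_i Y i *m M0 = M.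
  by apply/row_matrixP=> i; rewrite row_mul rowK YP.
have XY : \matrix_i X i *m \matrix_i Y i = 1%:M.
  apply/eqP; rewrite -subr_eq0; apply/eqP/row_matrixP=> i; rewrite row0.
  apply: freeM0; rewrite -row_mul mulmxBl -mulmxA YM XM mul1mx subrr.
  by rewrite row0.
have cY : c *m \matrix_i Y i = 0.
  by apply: freeM0; rewrite -mulmxA YM.
by rewrite -[c]mulmx1 -(mulmx1C XY) mulmxA cY mul0mx.
Qed.

End Main.

Theorem corollary5p6 (k : fieldType) (n : nat) (L : zmodClosed 'rV[int]_n) :
  binomial_complete_intersection (lattice_ideal k L) <->
  (lattice_sigma L =i pred1 (0 : 'rV[int]_(#|~: sigma L|)) \/
   exists (r : nat) (M : 'M[int]_(r, #|~: sigma L|)),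
     rows_basis M (lattice_sigma L) /\ mixed_dominating M).
Proof.
split=> [/connects_of_complete_intersection[r [M [freeM LM connM]]]|Lsigma].
  by right; apply: sigma_basis_of_connects LM connM.
have [r [M [basisM domM]]] : exists r (M : 'M[int]_(r, #|~: sigma L|)),
    rows_basis M (lattice_sigma L) /\ dominating M.
  case: Lsigma => [L0|[r [M [basisM [_ domM]]]]]; last by exists r, M.
  exists 0%N, 0; split; last by case=> // t f; case: (f ord0).
  apply/rows_basisP; split=> [c _|v]; first by apply/rowP=> -[].
  rewrite L0 inE; split=> [/eqP->|[c ->]]; last by rewrite mulmx0.
  by exists 0; rewrite mulmx0.
have [r' [M' [freeM' LM' connM']]] :=
  connects_of_sigma_basis basisM (connects_of_dominating domM).
exact: complete_intersection_of_connects LM' connM'.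
Qed.
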